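(* Let $\Delta$ be an affine ordered hovel and let $x,y\in\Delta$ be two different points. Then the cone topologies $\mathrm{Top}_x(\mathrm{Ch}(\partial\Delta))$ and $\mathrm{Top}_y(\mathrm{Ch}(\partial\Delta))$, with base points $x$ and $y$ respectively, are the same.
   Context: VECTORIAL DATA. $V$ is a finite dimensional real vector space, $I$ a finite non-empty set, $(\alpha_i)_{i\in I}$ a free family in $V^*$, $(\alpha_i^\vee)_{i\in I}$ a family in $V$ such that $\mathbb M=(\alpha_j(\alpha_i^\vee))_{i,j\in I}$ is a (possibly decomposable) generalized Cartan matrix. Put $r_i(v)=v-\alpha_i(v)\alpha_i^\vee$ and let $W^v\subset GL(V)$ be the group generated by the $r_i$. $\Phi=\{w(\alpha_i): w\in W^v,i\in I\}$ is the set of real roots; $\Phi_{im}\subset\bigoplus_i\mathbb Z\alpha_i\subset V^*$ is the set of imaginary roots of the Kac–Moody Lie algebra of $\mathbb M$. For $\alpha=w(\alpha_i)\in\Phi$, $\alpha^\vee=w(\alpha_i^\vee)$ and $r_\alpha(v)=v-\alpha(v)\alpha^\vee$. $C^v_f=\{v:\alpha_i(v)>0\ \forall i\}$. For $J\subset I$, $F^v(J)=\{v:\alpha_i(v)=0\ \forall i\in J,\ \alpha_i(v)>0\ \forall i\in I\setminus J\}$. Positive (negative) vectorial faces are the $w.F^v(J)$ (the $-w.F^v(J)$), $w\in W^v$; chambers if $J=\emptyset$, panels if $|J|=1$; spherical if $\langle r_i: i\in J\rangle$ is finite. $\mathcal T$ (resp. $\mathcal T^\circ$) is the union of all positive (resp.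 positive spherical) vectorial faces. MODEL APARTMENT. $\mathbb A$ is $V$ as an affine space with a set $\mathcal M$ of walls, hyperplanes of the form $M(\alpha,k)=\{v:\alpha(v)+k=0\}$, $\alpha\in\Phi$, $k\in\mathbb R$. Let $\Lambda_\alpha=\{k: M(\alpha,k)\in\mathcal M\}$ for $\alpha\in\Phi$ (assumed infinite and containing $0$), and $\Lambda_\alpha=\mathbb R$ for $\alpha\in\Phi_{im}$. $D(\alpha,k)=\{v:\alpha(v)+k\ge0\}$, $D(\alpha,\infty)=\mathbb A$. $W^a$ is the group generated by the affine reflections $r_M$ in walls $M=M(\alpha,k)$ (with linear part $r_\alpha$ and fixed set $M$); it is assumed to stabilize $\mathcal M$. Write $x\le y$ if $y-x\in\mathcal T$ and $x\stackrel{o}{<}y$ if $y-x\in\mathcal T^\circ$. FILTERS. A filter is contained in a set $S$ if $S$ belongs to it; $F\subset F'$ for filters if every member of $F'$ is a member of $F$; a map fixes a filter pointwise if it fixes pointwise some member. $\mathrm{germ}_x(S)$ is the filter of subsets containing the intersection of $S$ with a neighbourhood of $x$. The enclosure $cl_{\mathbb A}(F)$ is the filter of subsets containing some member of $F$ of the form $\bigcap_{\alpha\in\Phi\cup\Phi_{im}}D(\alpha,k_\alpha)$, $k_\alpha\in\Lambda_\alpha\cup\{\infty\}$. The support of $F$ is the smallest affine subspace containing it. Local face: $F^\ell(x,F^v)=\mathrm{germ}_x(x+F^v)$ ($x\in\mathbb A$, $F^v$ a vectorial face); closed face: enclosure of a local face. Sector: $x+C^v$ with $C^v$ a vectorial chamber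 (base point $x$, direction $C^v$). Chimney: $\mathfrak r(F,F^v)=cl_{\mathbb A}(F+F^v)$, $F$ a local face, $F^v$ a vectorial face; splayed if $F^v$ is spherical; solid if (the direction of) its support has finite pointwise stabilizer in $W^v$; its germ is the filter of subsets containing $\mathfrak r(F+\xi,F^v)$ for some $\xi\in F^v$. A ray with origin $x$ containing $y\ne x$ (or interval $(x,y]$) is preordered if $x\le y$ or $y\le x$, generic if $x\stackrel{o}{<}y$ or $y\stackrel{o}{<}x$; the germ of $(x,y]$ is $\mathrm{germ}_x((x,y])$. HOVEL. An apartment of type $\mathbb A$ is a set $A$ with a set $Isom^w(\mathbb A,A)$ of bijections which is of the form $\{f_0\circ w: w\in W^a\}$. A bijection $\varphi:A\to A'$ of apartments is a Weyl-isomorphism if $f'^{-1}\circ\varphi\circ f\in W^a$ for all $f\in Isom^w(\mathbb A,A)$, $f'\in Isom^w(\mathbb A,A')$. All notions above are transported to apartments. An affine ordered hovel of type $\mathbb A$ is a set $\Delta$ with a covering $\mathcal A$ by subsets (apartments) such that: (MA1) each $A\in\mathcal A$ has a structure of apartment of type $\mathbb A$; (MA2) if $F$ is a point, a germ of a preordered interval, a generic ray or a solid chimney in an apartment $A$ and $A'$ is another apartment containing $F$, then $A\cap A'\supset cl_A(F)$ and there is a Weyl-isomorphism $A\to A'$ fixing $cl_A(F)$ pointwise; (MA3) if $\mathfrak R$ is the germ of a splayed chimney and $F$ is a closed face or a germ of a solid chimney, some apartment contains $\mathfrak R$ and $F$; (MA4) if two apartments $A,A'$ contain such $\mathfrak R$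 and $F$, then $A\cap A'\supset cl_A(\mathfrak R\cup F)$ and there is a Weyl-isomorphism $A\to A'$ fixing $cl_A(\mathfrak R\cup F)$ pointwise; (MAO) if $x,y\in A\cap A'$ and $x\le_A y$, then $[x,y]_A=[x,y]_{A'}$. INFINITY. Two sectors (or generic rays) are, up to shortening, contained in a common apartment; they are parallel if, there, one is a translate of the other. Parallel classes of generic rays are ideal points; parallel classes of sectors are ideal chambers, and $\mathrm{Ch}(\partial\Delta)$ is the set of ideal chambers. Two ideal chambers (resp. ideal points) are opposite if they are classes in some apartment of sectors (resp. generic rays) with directions opposite to each other. An ideal point lies in (the interior of) $c$ if it is the class of a ray contained in a sector of class $c$. For $x\in\Delta$, an ideal chamber $c$ and an ideal point $\xi$, $Q_{x,c}$ is the unique sector of base point $x$ in class $c$ and $[x,\xi)$ is the unique generic ray of origin $x$ in class $\xi$. CONE TOPOLOGY. Choose in the interior of each ideal chamber $c$ an ideal point $\xi_c$ (its barycenter), in such a way that opposite ideal chambers have opposite barycenters. For $x\in\Delta$, $c\in\mathrm{Ch}(\partial\Delta)$ and $r\in[x,\xi_c)$, the standard open neighbourhood of $c$ with base point $x$ and gate $r$ is $U_{x,r,c}=\{c'\in\mathrm{Ch}(\partial\Delta):[x,r]\subsetneq[x,\xi_{c'})\cap[x,\xi_c)\}$. The cone topology $\mathrm{Top}_x(\mathrm{Ch}(\partial\Delta))$ with base point $x$ is the topology on $\mathrm{Ch}(\partial\Delta)$ generated by all $U_{x,r,c}$ with $c\in\mathrm{Ch}(\partial\Delta)$, $r\in[x,\xi_c)$.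 *)

(* Defs.v *)
From HB Require Import structures.
From mathcomp Require Import all_boot all_order all_algebra.
From mathcomp Require Import complex.
From mathcomp Require Import all_classical all_reals all_analysis.
Set Implicit Arguments.
Unset Strict Implicit.
Unset Printing Implicit Defensive.
Import Order.TTheory GRing.Theory Num.Theory VectorInternalTheory.
Import numFieldNormedType.Exports.
Local Open Scope classical_set_scope.
Local Open Scope ring_scope.

Definition gen_cartan_matrix (I : finType) (M : I -> I -> int) : Prop :=
  [/\ forall i, M i i = 2,
      forall i j, i != j -> M i j <= 0
    & forall i j, M i j = 0 -> M j i = 0].

Record lieAlgebra (K : fieldType) := LieAlgebra {
  lie_carrier :> lmodType K;
  lie : lie_carrier -> lie_carrier -> lie_carrier;
  lie_linear_l : forall y, linear (lie^~ y);
  lie_linear_r : forall x, linear (lie x);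
  lie_alternating : forall x, lie x x = 0;
  lie_jacobi : forall x y z,
    lie x (lie y z) + lie y (lie z x) + lie z (lie x y) = 0
}.

Definition lie_subspace (K : fieldType) (g : lieAlgebra K) (S : set g) : Prop :=
  S 0 /\ forall (a : K) (x y : g), S x -> S y -> S (a *: x + y).

Definition lie_subalgebra (K : fieldType) (g : lieAlgebra K) (S : set g) :=
  lie_subspace S /\ forall x y, S x -> S y -> S (lie x y).

Definition lie_ideal (K : fieldType) (g : lieAlgebra K) (S : set g) :=
  lie_subspace S /\ forall x y, S y -> S (lie x y).

(* The Kac-Moody Lie algebra g(M) over K, in the sense of Kac: a minimal
   realization (h, km_root, km_coroot) of M together with a Lie algebra
   generated by h and the e_i, f_i, satisfying the Chevalley relations, in which
   no nonzero ideal meets h trivially.  These data determine g(M) up to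
   isomorphism. *)
Record kac_moody (K : fieldType) (I : finType) (M : I -> I -> int) := KacMoody {
  km_lie :> lieAlgebra K;
  km_h : vectType K;
  km_root : I -> 'Hom(km_h, K^o);
  km_coroot : I -> km_h;
  km_in : {linear km_h -> km_lie};
  km_e : I -> km_lie;
  km_f : I -> km_lie;
  km_free_root : free (codom km_root);
  km_free_coroot : free (codom km_coroot);
  km_pairing : forall i j, km_root j (km_coroot i) = (M i j)%:~R;
  km_dim : (\dim {: km_h} +
    \rank (\matrix_(i < #|I|, j < #|I|)
             (M (enum_val i) (enum_val j))%:~R : 'M[K]_#|I|) = 2 * #|I|)%N;
  km_in_inj : injective km_in;
  km_hh : forall h h', lie (km_in h) (km_in h') = 0;
  km_ef : forall i j,
    lie (km_e i) (km_f j) = if i == j then km_in (km_coroot i) else 0;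
  km_he : forall h i, lie (km_in h) (km_e i) = (km_root i h : K) *: km_e i;
  km_hf : forall h i, lie (km_in h) (km_f i) = - (km_root i h : K) *: km_f i;
  km_generated : forall S : set km_lie, lie_subalgebra S ->
    (forall h, S (km_in h)) -> (forall i, S (km_e i)) -> (forall i, S (km_f i)) ->
    S = setT;
  km_reduced : forall S : set km_lie, lie_ideal S ->
    (forall h, S (km_in h) -> h = 0) -> S = [set 0]
}.

(* The element \sum_i n_i alpha_i of the root lattice is encoded by n. *)
Definition km_is_root (K : fieldType) (I : finType) (M : I -> I -> int)
    (g : kac_moody K M) (n : I -> int) : Prop :=
  (exists i, n i != 0) /\
  exists2 x : g, x != 0 &
    forall h, lie (km_in g h) x = (\sum_i (km_root g i h : K) *~ n i) *: x.

Record vectorial_data (R : realType) (V : vectType R) (I : finType) :=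
  VectorialData {
  alpha : I -> 'Hom(V, R^o);
  coroot : I -> V;
  cartan : I -> I -> int;
  index_nonempty : (0 < #|I|)%N;
  alpha_free : free (codom alpha);
  cartanE : forall i j, alpha j (coroot i) = (cartan i j)%:~R;
  cartan_gcm : gen_cartan_matrix cartan
}.

Section Vectorial.
Context (R : realType) (V : vectType R) (I : finType).
Variable D : vectorial_data V I.

Definition refl (i : I) : 'End(V) :=
  linfun (fun v : V => v - (alpha D i v : R) *: coroot D i).

(* The subgroup of GL(V) generated by the r_i, i in J: as r_i^2 = 1, it is the
   set of products of such r_i. *)
Inductive weyl (J : set I) : set 'End(V) :=
| weyl1 : weyl J \1%VF
| weylM i w : J i -> weyl J w -> weyl J (refl i \o w)%VF.

Definition Wv : set 'End(V) := weyl setT.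

Definition act_dual (w : 'End(V)) (a : 'Hom(V, R^o)) : 'Hom(V, R^o) :=
  (a \o w^-1)%VF.

Definition real_root : set 'Hom(V, R^o) :=
  [set a | exists2 w, Wv w & exists i, a = act_dual w (alpha D i)].

Definition imaginary_root : set 'Hom(V, R^o) :=
  [set a | exists (g : kac_moody R[i] (cartan D)) (n : I -> int),
     [/\ km_is_root g n, a = \sum_i alpha D i *~ n i & ~ real_root a]].

Definition base_face (J : set I) : set V :=
  [set v | (forall i, J i -> (alpha D i v : R) = 0) /\
           (forall i, ~ J i -> 0 < (alpha D i v : R))].

(* Positive face for s = false, negative face for s = true. *)
Definition vface (s : bool) (w : 'End(V)) (J : set I) : set V :=
  [set (-1) ^+ s *: w v | v in base_face J].

Definition spherical (J : set I) : Prop := finite_set (weyl J).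

Definition vectorial_face : set (set V) :=
  [set F | exists s w J, Wv w /\ F = vface s w J].

Definition spherical_face : set (set V) :=
  [set F | exists s w J, [/\ Wv w, spherical J & F = vface s w J]].

Definition chamber : set (set V) :=
  [set F | exists s w, Wv w /\ F = vface s w set0].

Definition tits : set V :=
  [set v | exists w J, Wv w /\ vface false w J v].

Definition tits_sph : set V :=
  [set v | exists w J, [/\ Wv w, spherical J & vface false w J v]].

Definition vle (x y : V) : Prop := tits (y - x).
Definition vlt (x y : V) : Prop := tits_sph (y - x).

Definition hyperplane (a : 'Hom(V, R^o)) (k : R) : set V :=
  [set v | (a v : R) + k = 0].

(* The reflection in M(w(alpha_i), k), with linear part r_(w(alpha_i)). *)
Definition affine_refl (w : 'End(V)) (i : I) (k : R) (v : V) : V :=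
  v - ((act_dual w (alpha D i) v : R) + k) *: w (coroot D i).

Inductive affine_weyl (walls : set (set V)) : set (V -> V) :=
| affine_weyl1 : affine_weyl walls id
| affine_weylM w i k f :
    Wv w -> walls (hyperplane (act_dual w (alpha D i)) k) ->
    affine_weyl walls f -> affine_weyl walls (affine_refl w i k \o f).

Record model_apartment := ModelApartment {
  wall : set (set V);
  wall_hyperplane : forall M, wall M ->
    exists a k, real_root a /\ M = hyperplane a k;
  wall_infinite : forall a, real_root a ->
    infinite_set [set k | wall (hyperplane a k)];
  wall_zero : forall a, real_root a -> wall (hyperplane a 0);
  wall_stable : forall f M, affine_weyl wall f -> wall M -> wall (f @` M)
}.

Variable AA : model_apartment.

Definition Wa : set (V -> V) := affine_weyl (wall AA).

Definition Lambda (a : 'Hom(V, R^o)) : set R :=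
  [set k | imaginary_root a \/ wall AA (hyperplane a k)].

Definition half_space (a : 'Hom(V, R^o)) (k : \bar R) : set V :=
  [set v | (0 <= (a v : R)%:E + k)%E].

Definition root_intersection (k : 'Hom(V, R^o) -> \bar R) : set V :=
  \bigcap_(a in real_root `|` imaginary_root) half_space a (k a).

(* Filters are set systems; a set S is identified with the filter [globally S],
   and a filter F is contained in S if F S holds. *)

Definition enclosure (F : set_system V) : set_system V :=
  [set S | exists k : 'Hom(V, R^o) -> \bar R,
     [/\ forall a, (real_root `|` imaginary_root) a ->
           ((EFin @` Lambda a) `|` [set +oo%E]) (k a),
         F (root_intersection k) & root_intersection k `<=` S]].

Definition vshift (x : V) (S : set V) : set V := [set x + v | v in S].

(* The topology of V is that of its coordinate space 'rV[R]_n. *)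
Definition germ (x : V) (S : set V) : set_system V :=
  [set T | \forall y \near v2r x, S (r2v y) -> T (r2v y)].

Definition local_face (x : V) (Fv : set V) : set_system V :=
  germ x (vshift x Fv).

Definition filter_add (F : set_system V) (S : set V) : set_system V :=
  [set T | exists2 X, F X & [set x + s | x in X & s in S] `<=` T].

Definition chimney (F : set_system V) (Fv : set V) : set_system V :=
  enclosure (filter_add F Fv).

Definition chimney_germ (F : set_system V) (Fv : set V) : set_system V :=
  [set S | exists2 xi, Fv xi & chimney (filter_add F [set xi]) Fv S].

Definition is_support (F : set_system V) (x : V) (U : {vspace V}) : Prop :=
  F (vshift x [set` U]) /\
  forall y (U' : {vspace V}), F (vshift y [set` U']) ->
    vshift x [set` U] `<=` vshift y [set` U'].

Definition solid (F : set_system V) : Prop :=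
  exists x (U : {vspace V}), is_support F x U /\
    finite_set [set w | Wv w /\ forall u, u \in U -> w u = u].

Definition closed_face : set (set_system V) :=
  [set F | exists x Fv, vectorial_face Fv /\ F = enclosure (local_face x Fv)].

Definition solid_chimney : set (set_system V) :=
  [set F | exists x F0 Fv, [/\ vectorial_face F0, vectorial_face Fv,
     solid (chimney (local_face x F0) Fv) &
     F = chimney (local_face x F0) Fv]].

Definition solid_chimney_germ : set (set_system V) :=
  [set F | exists x F0 Fv, [/\ vectorial_face F0, vectorial_face Fv,
     solid (chimney (local_face x F0) Fv) &
     F = chimney_germ (local_face x F0) Fv]].

Definition splayed_chimney_germ : set (set_system V) :=
  [set F | exists x F0 Fv, [/\ vectorial_face F0, spherical_face Fv &
     F = chimney_germ (local_face x F0) Fv]].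

Definition vsegment (x y : V) : set V :=
  [set x + t *: (y - x) | t in [set t : R | 0 <= t <= 1]].

Definition vsegment_oc (x y : V) : set V :=
  [set x + t *: (y - x) | t in [set t : R | 0 < t <= 1]].

Definition half_line (d : V) : set V :=
  [set t *: d | t in [set t : R | 0 <= t]].

Definition preordered (x y : V) : Prop := vle x y \/ vle y x.

(* Directions of generic rays: the ray x + half_line d has origin x and
   contains x + d. *)
Definition generic_line : set (set V) :=
  [set K | exists d, [/\ d != 0, vlt 0 d \/ vlt d 0 & K = half_line d]].

Definition MA2_filter : set (set_system V) :=
  [set F | [\/ exists x, F = globally [set x],
     exists x y, [/\ x != y, preordered x y & F = germ x (vsegment_oc x y)],
     exists x K, generic_line K /\ F = globally (vshift x K) |
     solid_chimney F]].

Variable Delta : Type.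

(* [chart A] stands for Isom^w(AA, A): a bijection from AA onto A is given as a
   map from V to Delta. *)
Record apartment_system := ApartmentSystem {
  apt : set (set Delta);
  chart : set Delta -> set (V -> Delta)
}.

Variable S : apartment_system.

(* Filters on an apartment are extended to filters on Delta; [fmap f F] is the
   transport of F by the chart f, and [pull f G] the inverse transport. *)
Definition transported (P : set (set_system V)) : set (set_system Delta) :=
  [set G | exists A f F, [/\ apt S A, chart S A f, P F & G = fmap f F]].

Definition pull (f : V -> Delta) (G : set_system Delta) : set_system V :=
  [set X | G (f @` X)].

Definition enclosure_in (f : V -> Delta) (G : set_system Delta) :
    set_system Delta :=
  fmap f (enclosure (pull f G)).

Definition weyl_iso (A A' : set Delta) (phi : Delta -> Delta) : Prop :=
  set_bij A A' phi /\
  forall f f', chart S A f -> chart S A' f' ->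
    exists2 w, Wa w & forall v, phi (f v) = f' (w v).

Definition fixes_pointwise (phi : Delta -> Delta) (G : set_system Delta) :=
  exists2 X, G X & forall z, X z -> phi z = z.

Definition share_enclosure (A A' : set Delta) (G : set_system Delta) : Prop :=
  forall f, chart S A f ->
    enclosure_in f G (A `&` A') /\
    exists2 phi, weyl_iso A A' phi & fixes_pointwise phi (enclosure_in f G).

Record is_hovel : Prop := IsHovel {
  hovel_cover : \bigcup_(A in apt S) A = setT;
  hovel_MA1 : forall A, apt S A -> exists2 f0 : V -> Delta,
    set_bij setT A f0 & chart S A = [set f0 \o w | w in Wa];
  hovel_MA2 : forall A A' f F, apt S A -> apt S A' -> chart S A f ->
    MA2_filter F -> fmap f F A' -> share_enclosure A A' (fmap f F);
  hovel_MA3 : forall RR F, transported splayed_chimney_germ RR ->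
    transported (closed_face `|` solid_chimney_germ) F ->
    exists A, [/\ apt S A, RR A & F A];
  hovel_MA4 : forall RR F A A', transported splayed_chimney_germ RR ->
    transported (closed_face `|` solid_chimney_germ) F ->
    apt S A -> apt S A' -> RR A -> F A -> RR A' -> F A' ->
    share_enclosure A A' (RR `&` F);  (* the filter union of RR and F *)
  hovel_MAO : forall A A' f f' a b a' b', apt S A -> apt S A' ->
    chart S A f -> chart S A' f' -> f a = f' a' -> f b = f' b' ->
    vle a b -> f @` vsegment a b = f' @` vsegment a' b'
}.

(* Sectors and generic rays are treated uniformly: they are the images by charts
   of the x + K, where K is in the family Ks of the vectorial chambers, resp.
   generic half-lines. *)
Definition conic (Ks : set (set V)) : set (set Delta) :=
  [set X | exists A f x K,
     [/\ apt S A, chart S A f, Ks K & X = f @` vshift x K]].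

Definition shortening (Ks : set (set V)) (X' X : set Delta) : Prop :=
  X' `<=` X /\
  exists A f x y K, [/\ apt S A, chart S A f, Ks K,
    X = f @` vshift x K & X' = f @` vshift y K].

Definition parallel (Ks : set (set V)) (X Y : set Delta) : Prop :=
  exists A f x y K, [/\ apt S A, chart S A f, Ks K,
    shortening Ks (f @` vshift x K) X & shortening Ks (f @` vshift y K) Y].

Definition parallel_class (Ks : set (set V)) (X : set Delta) : set (set Delta) :=
  [set Y | conic Ks Y /\ parallel Ks X Y].

Definition ideal (Ks : set (set V)) : set (set (set Delta)) :=
  parallel_class Ks @` conic Ks.

Definition opposite (Ks : set (set V)) (c c' : set (set Delta)) : Prop :=
  exists A f x y K, [/\ apt S A, chart S A f, Ks K,
    c = parallel_class Ks (f @` vshift x K) &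
    c' = parallel_class Ks (f @` vshift y (-%R @` K))].

Definition Ch : Type := set_type (ideal chamber).

(* The condition that the direction K = half_line d lies in the open chamber C,
   i.e. C d, excludes the rays of a sector that are parallel to its boundary. *)
Definition in_interior (xi c : set (set Delta)) : Prop :=
  exists A f x z C d, [/\ apt S A, chart S A f, chamber C & C d] /\
    [/\ vshift z (half_line d) `<=` vshift x C,
        c = parallel_class chamber (f @` vshift x C) &
        xi = parallel_class generic_line (f @` vshift z (half_line d))].

Definition barycenter_choice (bary : Ch -> set (set Delta)) : Prop :=
  [/\ forall c, ideal generic_line (bary c),
      forall c, in_interior (bary c) (val c) &
      forall c c', opposite chamber (val c) (val c') ->
        opposite generic_line (bary c) (bary c')].

(* [x, xi): the unique generic ray of origin x in the class xi. *)
Definition ray_to (x : Delta) (xi : set (set Delta)) : set Delta :=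
  get [set X | xi X /\ exists A f a K, [/\ apt S A, chart S A f,
                 generic_line K, f a = x & X = f @` vshift a K]].

(* [x, y] for x, y comparable in an apartment; unique by (MAO). *)
Definition segment (x y : Delta) : set Delta :=
  get [set X | exists A f a b, [/\ apt S A, chart S A f, preordered a b,
                 f a = x /\ f b = y & X = f @` vsegment a b]].

Variable bary : Ch -> set (set Delta).

Definition std_nbhd (x r : Delta) (c : Ch) : set Ch :=
  [set c' | segment x r `<` ray_to x (bary c') `&` ray_to x (bary c)].

Definition is_topology (T : Type) (O : set_system T) : Prop :=
  [/\ O setT, setI_closed O &
      forall F : set_system T, F `<=` O -> O (\bigcup_(X in F) X)].

Definition cone_topology (x : Delta) : set_system Ch :=
  smallest (@is_topology Ch)
    [set U | exists c r, ray_to x (bary c) r /\ U = std_nbhd x r c].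

End Vectorial.

(* Main.v *)
Require Import Defs.
From HB Require Import structures.
From mathcomp Require Import all_boot all_order all_algebra.
From mathcomp Require Import all_classical all_reals all_analysis.
From mathcomp Require Import complex zify ring lra.
Set Implicit Arguments.
Unset Strict Implicit.
Unset Printing Implicit Defensive.
Import Order.TTheory GRing.Theory Num.Theory VectorInternalTheory.
Import numFieldNormedType.Exports.
Local Open Scope classical_set_scope.
Local Open Scope ring_scope.

(** Real and imaginary roots have a constant sign on the fundamental chamber, so
every enclosure is convex for the order "v - u lies in the closed chamber".
Hence, by (MA2) and (MAO), two apartments sharing two points p, q with q - p in
an open chamber agree, through suitable charts, on the whole order interval
between p and q, and charts agreeing far out in a sector and reaching the same
point agree on the sector based there.

Let the rays from x and y towards the barycenter of c be given by charts f and h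
that agree far out, and suppose the ray from y towards the barycenter of c'
follows that of c beyond a point m deep in the sector.  The path that runs
straight from x to m in f and then turns into the end of the sector of c'
based at y is locally straight; moving back along it from m to x, (MA3) shows
that it lies in one apartment.  That apartment contains x and the end of c', so
it contains the ray from x towards the barycenter of c', and it agrees with f on
the order interval between x and m, which contains any prescribed initial part
of the ray from x towards the barycenter of c. *)

(** * Signs of real roots *)

Section WeylGroup.
Context (R : realType) (V : vectType R) (I : finType).
Variable D : vectorial_data V I.

Definition al (i : I) (v : V) : R := alpha D i v.

Lemma alD i u v : al i (u + v) = al i u + al i v.
Proof. exact: linearD. Qed.
Lemma alB i u v : al i (u - v) = al i u - al i v.
Proof. exact: linearB. Qed.
Lemma alN i u : al i (- u) = - al i u.
Proof. exact: linearN. Qed.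
Lemma alZ i k u : al i (k *: u) = k * al i u.
Proof. exact: linearZ. Qed.
Lemma al0 i : al i 0 = 0.
Proof. exact: linear0. Qed.

Lemma al_coroot i j : al j (coroot D i) = (cartan D i j)%:~R.
Proof. exact: cartanE. Qed.

Lemma cartan_diag i : cartan D i i = 2.
Proof. by have [] := cartan_gcm D. Qed.

Lemma reflE i v : refl D i v = v - al i v *: coroot D i.
Proof.
pose f (v : V) := v - al i v *: coroot D i.
have lf : linear f.
  move=> k u w; rewrite /f alD alZ scalerDl scalerBr opprD scalerA.
  by rewrite addrACA.
pose m := GRing.isLinear.Build R V V *:%R f lf.
pose F : {linear V -> V} := HB.pack f m.
exact: (lfunE F v).
Qed.

Lemma al_refl_self i v : al i (refl D i v) = - al i v.
Proof. rewrite reflE alB alZ al_coroot cartan_diag; ring. Qed.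

Lemma refl_invol i : involutive (refl D i).
Proof.
move=> v; rewrite !reflE alB alZ al_coroot cartan_diag.
rewrite -addrA -opprD -scalerDl.
have -> : al i v + (al i v - al i v * 2%:~R) = 0 by ring.
by rewrite scale0r subr0.
Qed.

(** Elements of $W^v$ are handled through words in the simple reflections, so that arguments on the
    length of an element become inductions on the size of a word. *)
Definition act (t : seq I) (v : V) : V := foldr (fun i => refl D i) v t.

Lemma act_cat s t v : act (s ++ t) v = act s (act t v).
Proof. by rewrite /act foldr_cat. Qed.

Lemma act_revK s : cancel (act s) (act (rev s)).
Proof.
elim: s => [//|i s IH] v.
by rewrite rev_cons -cats1 act_cat /= refl_invol IH.
Qed.

Lemma act_Krev s : cancel (act (rev s)) (act s).
Proof. by move=> v; rewrite -{1}(revK s) act_revK. Qed.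

Lemma Wv_act w : Wv D w -> exists t, w =1 act t.
Proof.
elim=> [|i {}w _ _ [t wt]]; first by exists [::] => v; rewrite id_lfunE.
by exists (i :: t) => v; rewrite comp_lfunE wt.
Qed.

Definition dominant : set V := [set v | forall i, 0 <= al i v].

Fixpoint alt (j i : I) (k : nat) : seq I :=
  if k is k'.+1 then j :: alt i j k' else [::].

Lemma size_alt j i k : size (alt j i k) = k.
Proof. by elim: k j i => //= k IH j i; rewrite IH. Qed.

Lemma altD j i k l : alt j i (k + l) =
  alt j i k ++ (if odd k then alt i j l else alt j i l).
Proof.
by elim: k j i => //= k IH j i; rewrite IH; case: (odd k).
Qed.

(** * Rank two: dihedral groups generated by two simple reflections *)

Section Rank2.
Variables (i j : I).
Hypothesis ij : i != j.
Let a : R := - (cartan D i j)%:~R.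
Let b : R := - (cartan D j i)%:~R.

Lemma act_coroots (z : V) (x y : R) :
  refl D i (z + x *: coroot D i + y *: coroot D j) =
    z + (- x - al i z + b * y) *: coroot D i + y *: coroot D j /\
  refl D j (z + x *: coroot D i + y *: coroot D j) =
    z + x *: coroot D i + (- y - al j z + a * x) *: coroot D j.
Proof.
have e1 (p q r : R) (c d : V) : z + p *: c + q *: d - r *: c = z + (p - r) *: c + q *: d.
  by rewrite scalerBl addrA -!addrA; congr (_ + (_ + _)); rewrite addrC.
have e2 (p q r : R) (c d : V) : z + p *: c + q *: d - r *: d = z + p *: c + (q - r) *: d.
  by rewrite scalerBl addrA.
rewrite !reflE !alD !alZ !al_coroot !cartan_diag /a /b e1 e2.
by split; congr (_ + _ *: _ + _ *: _); ring.
Qed.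

(** The four cases are the finite types $A_1\times A_1$, $A_2$, $B_2$, $G_2$, with [m] the order of
    $r_ir_j$. Both reflections move a vector only along the two coroots, so the relation is checked
    on the two coefficients, starting from zero. *)
Lemma braid m :
  (a == 0) && (b == 0) && (m == 2)%N || (a * b == 1) && (m == 3)%N
    || (a * b == 2) && (m == 4)%N || (a * b == 3) && (m == 6)%N ->
  act (alt i j m) =1 act (alt j i m).
Proof.
move=> H z.
have -> : z = z + 0 *: coroot D i + 0 *: coroot D j.
  by rewrite !scale0r !addr0.
case/orP: H => [/orP[/orP[]|]|].
- move=> /andP[/andP[/eqP a0 /eqP b0] /eqP ->] /=.
  rewrite !(act_coroots _ _ _).1 !(act_coroots _ _ _).2.
  rewrite !(act_coroots _ _ _).1 ?(act_coroots _ _ _).2 a0 b0.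
  congr (_ + _ *: _ + _ *: _); ring.
- move=> /andP[/eqP ab /eqP ->] /=.
  do 3! rewrite ?(act_coroots _ _ _).1 ?(act_coroots _ _ _).2.
  congr (_ + _ *: _ + _ *: _); ring: ab.
- move=> /andP[/eqP ab /eqP ->] /=.
  do 4! rewrite ?(act_coroots _ _ _).1 ?(act_coroots _ _ _).2.
  congr (_ + _ *: _ + _ *: _); ring: ab.
move=> /andP[/eqP ab /eqP ->] /=.
do 6! rewrite ?(act_coroots _ _ _).1 ?(act_coroots _ _ _).2.
congr (_ + _ *: _ + _ *: _); ring: ab.
Qed.

Lemma al_refl v :
  [/\ al i (refl D i v) = - al i v, al j (refl D i v) = al j v + a * al i v,
      al j (refl D j v) = - al j v & al i (refl D j v) = al i v + b * al j v].
Proof.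
rewrite !reflE !alB !alZ !al_coroot !cartan_diag /a /b; split; ring.
Qed.

Lemma double_le (p q x y : R) : 4 <= p * q -> 0 <= p -> 0 <= x ->
  q * x <= 2 * y -> 2 * x <= p * y.
Proof. by move=> pq p0 x0 /(ler_wpM2l p0); move: (ler_wpM2r x0 pq); lra. Qed.

(** The third conjunct is the induction invariant: the coefficient changed last is at least half of
    what the other one contributes to it. With [4 <= a * b] this keeps the next new coefficient
    nonnegative and passes to the next step with the two roles exchanged. *)
Lemma alt_coef_inf k : 4 <= a * b -> 0 <= a -> 0 <= b ->
  exists x y, [/\ 0 <= x, 0 <= y, (if odd k then b * x <= 2 * y else a * y <= 2 * x) &
    forall v, al i (act (alt j i k) v) = x * al i v + y * al j v].
Proof.
move=> ab a0 b0; elim: k => [|k [x [y [x0 y0 xy E]]]].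
  by exists 1, 0; split=> [||/=|v] //; [rewrite mulr0 mulr1 ler0n|rewrite mul1r mul0r addr0].
rewrite -addn1 oddD /=.
case ok: (odd k) xy E => /= xy E.
  exists (a * y - x), y.
  have ab2 : 2 * x <= a * y by exact: double_le ab _ _ xy.
  split=> // [||v]; [lra|lra|].
  by rewrite altD act_cat E ok /=; case: (al_refl v) => -> -> _ _; ring.
exists x, (b * x - y).
have ab2 : 2 * y <= b * x.
  by apply: double_le xy => //; rewrite mulrC.
split=> // [||v]; [lra|lra|].
by rewrite altD act_cat E ok /=; case: (al_refl v) => _ _ -> ->; ring.
Qed.

(** Below the order [m] the coefficients are listed explicitly, type by type; they are the positive
    roots of the rank two system in the orbit of $\alpha_i$. *)
Lemma alt_coef_fin k m : 0 <= b -> (k < m)%N ->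
  (a == 0) && (b == 0) && (m == 2)%N || (a * b == 1) && (m == 3)%N
    || (a * b == 2) && (m == 4)%N || (a * b == 3) && (m == 6)%N ->
  exists x y, [/\ 0 <= x, 0 <= y &
    forall v, al i (act (alt j i k) v) = x * al i v + y * al j v].
Proof.
move=> b0 km H.
have r1 v : al i (refl D i v) = - al i v by have [] := al_refl v.
have r2 v : al j (refl D i v) = al j v + a * al i v by have [] := al_refl v.
have r3 v : al j (refl D j v) = - al j v by have [] := al_refl v.
have r4 v : al i (refl D j v) = al i v + b * al j v by have [] := al_refl v.
have rr := (r1, r2, r3, r4).
case/orP: H => [/orP[/orP[]|]|].
- move=> /andP[/andP[/eqP a0 /eqP b00] /eqP mE]; subst m.
  case: k km => [|[|//]] _ /=; exists 1, 0; split=> // v; rewrite ?rr ?b00; ring.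
- move=> /andP[/eqP ab /eqP mE]; subst m.
  case: k km => [|[|[|//]]] _ /=;
    [exists 1, 0|exists 1, b|exists 0, b]; split=> // v; rewrite ?rr; ring: ab.
- move=> /andP[/eqP ab /eqP mE]; subst m.
  case: k km => [|[|[|[|//]]]] _ /=;
    [exists 1, 0|exists 1, b|exists 1, b|exists 1, 0]; split=> // v;
    rewrite ?rr; ring: ab.
move=> /andP[/eqP ab /eqP mE]; subst m.
case: k km => [|[|[|[|[|[|//]]]]]] _ /=;
  [exists 1, 0|exists 1, b|exists 2, b|exists 2, b|exists 1, b|exists 1, 0];
  split=> // v; rewrite ?rr; ring: ab.
Qed.

(** If the integer [a * b] is below 4 it is one of 0, 1, 2, 3, and it is 0 only when both entries
    vanish, by the symmetry of zeros of a generalized Cartan matrix. *)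
Lemma cartan_cases : 0 <= a /\ 0 <= b /\ (4 <= a * b \/ exists m,
  (a == 0) && (b == 0) && (m == 2)%N || (a * b == 1) && (m == 3)%N
    || (a * b == 2) && (m == 4)%N || (a * b == 3) && (m == 6)%N).
Proof.
have [_ np z] := cartan_gcm D.
have := np _ _ ij; have := np j i; rewrite eq_sym => /(_ ij).
have := z i j; have := z j i; rewrite /a /b.
move: (cartan D i j) (cartan D j i) => x y zy zx y0 x0.
rewrite !oppr_ge0 !lerz0 mulrNN -intrM !oppr_eq0 !intr_eq0.
split=> //; split=> //.
have [xy4|xy4] := leP 4 (x * y).
  by left; rewrite (_ : 4 = 4%:~R) // ler_int.
right; have [x00|xn0] := eqVneq x 0.
  by exists 2; rewrite (zx x00) !eqxx.
have yn0 : y != 0 by apply: contra_neq xn0 => /zy.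
have xy0 : 0 < x * y by rewrite nmulr_rgt0 // lt_neqAle ?xn0 ?yn0.
have : [\/ x * y = 1, x * y = 2 | x * y = 3].
  move: (x * y) xy0 xy4 => z0 z1 z2.
  have [->|[->|->]] : z0 = 1 \/ z0 = 2 \/ z0 = 3 by lia.
  - by constructor 1. - by constructor 2. - by constructor 3.
by case=> ->; [exists 3|exists 4|exists 6]; rewrite !eqxx ?orbT.
Qed.

Lemma rank2_positive k :
  (exists x y, [/\ 0 <= x, 0 <= y &
     forall v, al i (act (alt j i k) v) = x * al i v + y * al j v]) \/
  (exists2 t, (size t < k)%N & forall v, act t v = refl D i (act (alt j i k) v)).
Proof.
have [a0 [b0 [ab|[m Hm]]]] := cartan_cases.
  by left; have [x [y [x0 y0 _ E]]] := alt_coef_inf k ab a0 b0; exists x, y.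
have [km|mk] := ltnP k m; first by left; exact: alt_coef_fin km Hm.
(* From length [m] on, the braid relation makes the first [m] letters begin with [i], and that
   letter cancels against the reflection in front. *)
right; have m0 : (0 < m)%N by case: m Hm {mk} => //=; rewrite !andbF.
pose l := if odd m then alt i j (k - m) else alt j i (k - m).
exists (alt j i m.-1 ++ l).
  rewrite size_cat size_alt /l; case: (odd m); rewrite size_alt; lia.
move=> v; rewrite -[in RHS](subnKC mk) altD -/l !act_cat -(braid Hm).
by case: m m0 {Hm mk} l => //= m _ l; rewrite refl_invol.
Qed.

End Rank2.

(* Tits' lemma for [w = (act t)^-1], as [w(alpha_i)] is [v |-> al i (act t v)]. *)
Lemma positive_or_shorter t i :
  (forall v, dominant v -> 0 <= al i (act t v)) \/
  (exists2 t', (size t' < size t)%N & forall v, act t' v = refl D i (act t v)).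
Proof.
have [n] := ubnP (size t); elim: n t i => // n IH [|j t1] i /= lt_n.
  by left=> v; apply.
have [<-|ij] := eqVneq i j.
  by right; exists t1 => // v; rewrite refl_invol.
have IH' t2 i2 : (size t2 <= size t1)%N -> _ := fun h => IH t2 i2 (leq_ltn_trans h lt_n).
(* The element is written as an alternating word in [i], [j] times a remainder [u]; a second
   induction shortens [u] at the expense of the alternating word. *)
suff inner u k : (0 < k)%N -> (size u + k <= (size t1).+1)%N ->
    (forall v, refl D j (act t1 v) = act (alt j i k) (act u v)) ->
    (forall v, dominant v -> 0 <= al i (refl D j (act t1 v))) \/
    (exists2 t', (size t' < (size t1).+1)%N &
       forall v, act t' v = refl D i (refl D j (act t1 v))).
  by apply: (inner t1 1%N) => //; rewrite addn1.
have [p] := ubnP (size u); elim: p u k => // p IHp u k lt_p k0 uk E.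
have altl : exists2 l', l' = (if odd k then i else j) &
   forall v, act (alt j i k.+1) v = act (alt j i k) (refl D l' v).
  exists (if odd k then i else j) => // v.
  by rewrite -addn1 altD act_cat; case: (odd k).
have altl1 : forall v, act (alt j i k) v =
    act (alt j i k.-1) (refl D (if odd k then j else i) v).
  move=> v; case: k k0 {uk E altl} => // k _.
  by rewrite -addn1 altD act_cat addn1 /=; case: (odd k).
have su : (size u <= size t1)%N by lia.
have [l' l'E El'] := altl.
(* [l'] is the letter that continues the alternation. If it shortens [u], it moves from [u] into the
   alternating word. *)
have [pos'|[u' su' Eu']] := IH' u l' su; last first.
  apply: (IHp u' k.+1) => //; [lia|lia|] => v.
  by rewrite El' Eu' refl_invol.
(* The other letter ends the alternating word. If it shortens [u], it cancels there too, and the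
   outer induction applies to a strictly shorter word for the same element. *)
have [pos|[u' su' Eu']] := IH' u (if odd k then j else i) su; last first.
  have Et v : refl D j (act t1 v) = act (alt j i k.-1 ++ u') v.
    by rewrite act_cat E altl1 Eu'.
  have [|h|[t' st' Et']] := IH' (alt j i k.-1 ++ u') i.
  - rewrite size_cat size_alt; lia.
  - by left=> v /h; rewrite Et.
  right; exists t'; last by move=> v; rewrite Et' Et.
  by apply: (ltn_trans st'); rewrite size_cat size_alt; lia.
(* Now $\alpha_i$ and $\alpha_j$ are nonnegative on the image under [u] of every dominant vector, so
   rank two decides: either a nonnegative combination of them appears, or the alternating word
   shortens. *)
have [[x [y [x0 y0 Exy]]]|[t' st' Et']] := rank2_positive ij k.
  left=> v dv; rewrite E Exy; apply: addr_ge0; apply: mulr_ge0 => //;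
  by move: (pos _ dv) (pos' _ dv); rewrite l'E; case: (odd k).
right; exists (t' ++ u); first by rewrite size_cat; lia.
by move=> v; rewrite act_cat Et' E.
Qed.

(** When the root is not shown to be nonnegative, $r_i$ times the word has a shorter expression, for
    which the claim is known; composing with $r_i$ changes the sign. *)
Lemma act_root_sign t i :
  (forall v, dominant v -> 0 <= al i (act t v)) \/
  (forall v, dominant v -> al i (act t v) <= 0).
Proof.
have [n] := ubnP (size t); elim: n t => // n IH t lt_n.
have [|[t' st Et]] := positive_or_shorter t i; first by left.
have [h|h] := IH t' (leq_trans st lt_n); [right|left] => v /h.
all: by rewrite Et al_refl_self ?oppr_ge0 ?oppr_le0.
Qed.
End WeylGroup.

(** * Regular vectors and the affine Weyl group *)

Section AffineWeyl.
Context (R : realType) (V : vectType R) (I : finType).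
Variables (D : vectorial_data V I) (AA : model_apartment D).
Local Notation al := (al D).
Local Notation act := (act D).

Lemma actB t u v : act t (u - v) = act t u - act t v.
Proof. by elim: t => //= i t ->; rewrite linearB. Qed.
Lemma actD t u v : act t (u + v) = act t u + act t v.
Proof. by elim: t => //= i t ->; rewrite linearD. Qed.
Lemma actZ t k v : act t (k *: v) = k *: act t v.
Proof. by elim: t => //= i t ->; rewrite linearZ. Qed.

Lemma act_inj t : injective (act t).
Proof. exact: can_inj (act_revK _ _). Qed.

(* Strict dominance order, reversed if [s = true]: [v - u] lies in the chamber
   [C^v_f], resp. [- C^v_f]. *)
Definition slt (s : bool) (u v : V) : Prop :=
  forall i, 0 < (-1) ^+ s * al i (v - u).

(** Freeness of the action on chambers. If the word begins with [j], either it has a shorter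
    expression, or $\alpha_j$ is nonnegative before the last reflection $r_j$ is applied, hence
    nonpositive afterwards, and the image leaves the open chamber. *)
Lemma act_regular s t d : slt s 0 d -> slt s 0 (act t d) -> act t =1 id.
Proof.
have dom v : slt s 0 v -> dominant D ((-1) ^+ s *: v).
  by move=> h i; rewrite alZ; have := h i; rewrite subr0 => /ltW.
move=> dr; have [n] := ubnP (size t); elim: n t => // n IH [|j t] //= lt_n tr.
have [pos|[t' st Et]] := positive_or_shorter D t j; last first.
  have lt' : (size t' < n)%N by apply: (ltn_trans st); rewrite -ltnS.
  have tr' : slt s 0 (act t' d) by rewrite Et.
  by move=> v; exact: etrans (esym (Et v)) (IH t' lt' tr' v).
have := tr j; rewrite subr0 al_refl_self mulrN oppr_gt0 ltNge.
by rewrite -alZ -actZ pos //; exact: dom.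
Qed.

Lemma Wv_inv (w : 'End(V)) t v : w =1 act t -> w^-1%VF v = act (rev t) v.
Proof.
move=> wt; apply: (@act_inj t); rewrite act_Krev -wt lker0_lfunVK //.
by apply/lker0P => x y; rewrite !wt => /act_inj.
Qed.

Definition signed (a : 'Hom(V, R^o)) : Prop :=
  (forall v, dominant D v -> 0 <= (a v : R)) \/
  (forall v, dominant D v -> (a v : R) <= 0).

Lemma real_root_signed a : real_root D a -> signed a.
Proof.
move=> [w Ww [i ->]]; have [t wt] := Wv_act Ww.
by case: (act_root_sign D (rev t) i) => h; [left|right] => v /h;
  rewrite /act_dual comp_lfunE (Wv_inv _ wt).
Qed.

Lemma affine_reflE (w : 'End(V)) t i k v : w =1 act t ->
  affine_refl D w i k v =
    v - (al i (act (rev t) v) + k) *: act t (coroot D i).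
Proof.
by move=> wt; rewrite /affine_refl /act_dual comp_lfunE (Wv_inv _ wt) wt.
Qed.

Lemma affine_refl_invol w i k : Wv D w -> involutive (affine_refl D w i k).
Proof.
move=> /Wv_act[t wt] v; rewrite !(affine_reflE _ _ _ wt).
rewrite actB alB actZ alZ act_revK al_coroot cartan_diag -addrA -opprD -scalerDl.
have e (x : R) : x + k + (x - (x + k) * 2%:~R + k) = 0 by ring.
by rewrite e scale0r subr0.
Qed.

Lemma affine_refl_linear (w : 'End(V)) t i k u v : w =1 act t ->
  affine_refl D w i k v - affine_refl D w i k u =
    act (t ++ i :: rev t) (v - u).
Proof.
move=> wt; rewrite !(affine_reflE _ _ _ wt) act_cat /= reflE actB actZ act_Krev.
rewrite actB alB opprB addrCA addrC -!addrA; congr (_ + _).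
by rewrite addrCA; congr (_ + _); rewrite addrC -scalerBl -scaleNr; congr (_ *: _); ring.
Qed.

Lemma Wa_linear f : Wa AA f -> exists t, forall u v, f v - f u = act t (v - u).
Proof.
elim=> [|w i k {}f Ww _ _ [t ft]]; first by exists [::].
have [t' wt'] := Wv_act Ww.
exists ((t' ++ i :: rev t') ++ t) => u v.
by rewrite act_cat -ft -(affine_refl_linear i k (f u) (f v) wt').
Qed.

Lemma Wa_comp f g : Wa AA f -> Wa AA g -> Wa AA (f \o g).
Proof.
move=> Wf Wg; elim: Wf => // w i k {}f Ww Mw _ IH.
exact: affine_weylM Ww Mw IH.
Qed.

Lemma Wa_inv f : Wa AA f -> exists g, [/\ Wa AA g, cancel f g & cancel g f].
Proof.
elim=> [|w i k {}f Ww Mw _ [g [Wg fg gf]]].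
  by exists id; split=> //; exact: affine_weyl1.
have rr := affine_refl_invol i k Ww.
exists (g \o affine_refl D w i k); split=> [|v|v] /=.
- apply: Wa_comp => //.
  rewrite -[affine_refl _ _ _ _]/(affine_refl D w i k \o id).
  by apply: affine_weylM => //; exact: affine_weyl1.
- by rewrite rr fg.
- by rewrite gf rr.
Qed.

(** Every root has a wall through the origin, so the simple reflections are themselves affine
    reflections in walls. *)
Lemma Wa_act t : Wa AA (act t).
Proof.
elim: t => [|i t IH]; first exact: affine_weyl1.
have -> : act (i :: t) = affine_refl D \1%VF i 0 \o act t.
  apply/funext => v /=; rewrite (@affine_reflE _ [::]) /=; last by move=> x; rewrite id_lfunE.
  by rewrite reflE addr0.
apply: affine_weylM => //; first exact: weyl1.
by apply: wall_zero; exists \1%VF; [exact: weyl1|exists i].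
Qed.
End AffineWeyl.

(** * Signs of imaginary roots *)

Lemma free_codomP (K : fieldType) (vT : vectType K) (I : finType) (f : I -> vT)
    (k : I -> K) :
  free (codom f) -> \sum_i k i *: f i = 0 -> forall i, k i = 0.
Proof.
move=> fr s0 i.
pose X := codom_tuple f.
have /freeP/(_ (fun j => k (enum_val j))) := (fr : free X).
have -> : \sum_(j < #|I|) k (enum_val j) *: X`_j = 0.
  rewrite -[RHS]s0 (reindex (@enum_val I I)) /=; last first.
    by apply: onW_bij; exact: enum_val_bij.
  apply: eq_bigr => j _; congr (_ *: _).
  rewrite /X /= /codom /image_mem (nth_map i) -?cardE ?ltn_ord //.
  by rewrite -(enum_val_nth i j).
by move=> /(_ erefl (enum_rank i)); rewrite enum_rankK.
Qed.

Section KacMoodyRoots.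
Context (K : numFieldType) (I : finType) (M : I -> I -> int).
Variable g : kac_moody K M.
Local Notation br := (@lie K (km_lie g)).

Lemma lieDl (x y z : g) : br (x + y) z = br x z + br y z.
Proof. by have := lie_linear_l z 1 x y; rewrite !scale1r. Qed.
Lemma lieDr (x y z : g) : br z (x + y) = br z x + br z y.
Proof. by have := lie_linear_r z 1 x y; rewrite !scale1r. Qed.
Lemma lie0r (z : g) : br z 0 = 0.
Proof. by apply: (addrI (br z 0)); rewrite -lieDr !addr0. Qed.
Lemma lie0l (z : g) : br 0 z = 0.
Proof. by apply: (addrI (br 0 z)); rewrite -lieDl !addr0. Qed.
Lemma lieZr k (x z : g) : br z (k *: x) = k *: br z x.
Proof. by have := lie_linear_r z k x 0; rewrite lie0r !addr0. Qed.
Lemma lieZl k (x z : g) : br (k *: x) z = k *: br x z.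
Proof. by have := lie_linear_l z k x 0; rewrite lie0l !addr0. Qed.
Lemma lieC (x y : g) : br x y = - br y x.
Proof.
have := lie_alternating (x + y).
rewrite lieDl !lieDr !lie_alternating add0r addr0 => /eqP.
by rewrite addr_eq0 => /eqP.
Qed.
Lemma lie_leibniz (x y z : g) : br x (br y z) = br (br x y) z + br y (br x z).
Proof.
have := lie_jacobi x y z; rewrite [br z (br x y)]lieC [br z x]lieC.
have -> : br y (- br x z) = - br y (br x z) by rewrite -scaleN1r lieZr scaleN1r.
by move=> /eqP; rewrite subr_eq0 subr_eq => /eqP.
Qed.

Definition weight (n : I -> int) (h : km_h g) : K :=
  \sum_i (km_root g i h : K) *~ n i.

Definition of_weight (n : I -> int) : set g :=
  [set x | forall h, br (km_in g h) x = weight n h *: x].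

(** The simple roots are linearly independent and the base field has characteristic 0, so integer
    coefficients are recovered from the weight. *)
Lemma weight_inj n n' : weight n =1 weight n' -> n =1 n'.
Proof.
move=> e i; apply/eqP; rewrite -subr_eq0 -(intr_eq0 K); apply/eqP; move: i.
apply: (free_codomP (km_free_root g)).
apply/lfunP => h; rewrite sum_lfunE zero_lfunE.
under eq_bigr => i _ do rewrite scale_lfunE mulrzBr scalerBl -[_ *: _]/(_ * _)
  -[X in _ - X]/(_ * _) !mulrzl.
by rewrite sumrB -[X in X - _]/(weight n h) e subrr.
Qed.

Lemma of_weightZ n k x : of_weight n x -> of_weight n (k *: x).
Proof. by move=> wx h; rewrite lieZr wx !scalerA mulrC. Qed.

(** Weight spaces of distinct weights are independent. An [h] separating [n] from the first weight
    is chosen; bracketing with it and subtracting the first weight at [h] kills the first summand,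
    rescales the others, and multiplies [x] by a nonzero scalar. *)
Lemma weight_independent n (l : seq ((I -> int) * g)) (x : g) :
  of_weight n x -> x = \sum_(y <- l) y.2 ->
  (forall y, List.In y l -> of_weight y.1 y.2 /\ ~ (y.1 =1 n)) -> x = 0.
Proof.
have [k] := ubnP (size l); elim: k l x => // k IH [|[n1 x1] l] x /= lt_k wx.
  by rewrite big_nil.
rewrite big_cons /= => xE lP.
have [w1 nn1] := lP (n1, x1) (or_introl erefl).
have [h hP] : exists h, weight n h != weight n1 h.
  apply: contrapT => /forallNP H; apply: nn1; apply: weight_inj => h.
  by apply/eqP; move: (H h) => /negP; rewrite negbK eq_sym.
have c0 : weight n h - weight n1 h != 0 by rewrite subr_eq0.
suff : (weight n h - weight n1 h) *: x = 0.
  by move=> /eqP; rewrite scaler_eq0 (negPf c0) => /eqP.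
pose l' := [seq (y.1, (weight y.1 h - weight n1 h) *: y.2) | y <- l].
apply: (IH l'); first by rewrite size_map.
- exact: of_weightZ.
- have := congr1 (br (km_in g h)) xE; rewrite lieDr wx w1.
  rewrite scalerBl => ->; rewrite xE scalerDr opprD addrACA subrr add0r.
  have -> : br (km_in g h) (\sum_(y <- l) y.2) =
      \sum_(y <- l) weight y.1 h *: y.2.
    have {}lP y : List.In y l -> of_weight y.1 y.2 by move=> ?; case: (lP y); auto.
    elim: l lP {xE lt_k l'} => [|y l IHl] lP; first by rewrite !big_nil lie0r.
    by rewrite !big_cons lieDr lP /=; auto; rewrite IHl //; move=> *; apply: lP; right.
  rewrite scaler_sumr -sumrB big_map; apply: eq_bigr => y _ /=.
  by rewrite scalerBl.
move=> y /List.in_map_iff[z [<- zl]] /=.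
by have [? ?] := lP z (or_intror zl); split=> //; exact: of_weightZ.
Qed.

Inductive lspan (P : set g) : set g :=
| lspan0 : lspan P 0
| lspanD k x y : P x -> lspan P y -> lspan P (k *: x + y).

Lemma lspan_gen P x : P x -> lspan P x.
Proof. by move=> Px; rewrite -[x]addr0 -[x]scale1r; apply: lspanD => //; exact: lspan0. Qed.

Lemma lspan_add P x y : lspan P x -> lspan P y -> lspan P (x + y).
Proof.
by elim=> [|k {}x z Px _ IH] Py; rewrite ?add0r // -addrA; apply: lspanD; auto.
Qed.

Lemma lspanZ P k x : lspan P x -> lspan P (k *: x).
Proof.
elim=> [|l {}x z Px _ IH]; first by rewrite scaler0; exact: lspan0.
by rewrite scalerDr scalerA; exact: lspanD.
Qed.

Lemma lspan_sub P Q x : (forall y, P y -> lspan Q y) -> lspan P x -> lspan Q x.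
Proof.
move=> PQ; elim=> [|k {}x z Px _ IH]; first exact: lspan0.
by apply: lspan_add => //; apply: lspanZ; exact: PQ.
Qed.

Lemma lspan_br P Q z x :
  (forall y, P y -> lspan Q (br z y)) -> lspan P x -> lspan Q (br z x).
Proof.
move=> PQ; elim=> [|k {}x y Px _ IH]; first by rewrite lie0r; exact: lspan0.
by rewrite lieDr lieZr; apply: lspan_add => //; apply: lspanZ; exact: PQ.
Qed.

Inductive monomial (e : I -> g) : set g :=
| monomial1 i : monomial e (e i)
| monomialM i x : monomial e x -> monomial e (br (e i) x).

Lemma monomial_weight (e : I -> g) (s : int) x :
  (forall h i, br (km_in g h) (e i) = ((km_root g i h : K) *~ s) *: e i) ->
  monomial e x -> exists n : I -> nat, of_weight (fun i => s * n i) x.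
Proof.
move=> He; elim=> [i|i {}x _ [n wn]].
  exists (fun j => (i == j)%N : nat) => h; rewrite He; congr (_ *: _).
  rewrite /weight (bigD1 i) //= eqxx mulr1 big1 ?addr0 // => j /negPf.
  by rewrite eq_sym => ->; rewrite mulr0.
exists (fun j => ((i == j) + n j)%N) => h.
rewrite lie_leibniz He wn lieZl lieZr -scalerDl; congr (_ *: _).
rewrite /weight; under [RHS]eq_bigr => j _ do rewrite PoszD mulrDr mulrzDr.
rewrite big_split /=; congr (_ + _).
rewrite (bigD1 i) //= eqxx mulr1 big1 ?addr0 // => j /negPf.
by rewrite eq_sym => ->; rewrite mulr0.
Qed.

(** Stated for two abstract families so that it serves both for the $e_i$ acting on products of the
    $f_j$ and for the reverse. By the Leibniz rule one generator meets one opposite generator at a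
    time, and their bracket falls into the Cartan part. *)
Lemma bracket_monomial (e f : I -> g) :
  (forall i j, exists h, br (e i) (f j) = km_in g h) ->
  (forall h x, monomial f x -> exists k, br (km_in g h) x = k *: x) ->
  forall i x, monomial f x ->
    lspan (monomial f `|` range (km_in g)) (br (e i) x).
Proof.
move=> ef hf i x; elim=> [j|j {}x fx IH].
  by have [h ->] := ef i j; apply: lspan_gen; right; exists h.
rewrite lie_leibniz; apply: lspan_add.
  have [h ->] := ef i j; have [k ->] := hf h x fx.
  by apply: lspanZ; apply: lspan_gen; left.
apply: lspan_br IH => y [fy|[h _ <-]].
  by apply: lspan_gen; left; exact: monomialM.
have [k E] := hf h (f j) (monomial1 f j).
by rewrite lieC E -scaleNr; apply: lspanZ; apply: lspan_gen; left; exact: monomial1.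
Qed.

Lemma monomial_e_weight x : monomial (km_e g) x ->
  exists n : I -> nat, of_weight (fun i => (1 : int) * n i) x.
Proof. by apply: monomial_weight => h i; rewrite km_he. Qed.

Lemma monomial_f_weight x : monomial (km_f g) x ->
  exists n : I -> nat, of_weight (fun i => (-1 : int) * n i) x.
Proof. by apply: monomial_weight => h i; rewrite km_hf mulrNz mulr1z. Qed.

Lemma triangular_decomposition (x : g) :
  lspan (monomial (km_e g) `|` (monomial (km_f g) `|` range (km_in g))) x.
Proof.
set P := _ `|` _.
(* The stabilizer of the span is a subalgebra by the Jacobi identity. Once it contains the
   generators it is everything, so the span is itself a subalgebra containing the generators. *)
pose S : set g := [set z | forall y, lspan P y -> lspan P (br z y)].
have SE i : S (km_e g i).
  move=> y; apply: lspan_br => {}y [ye|[yf|[h _ <-]]].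
  - by apply: lspan_gen; left; exact: monomialM.
  - apply: (@lspan_sub (monomial (km_f g) `|` range (km_in g))).
      by move=> z Pz; apply: lspan_gen; right.
    apply: bracket_monomial yf => [i' j|h z /monomial_f_weight[n wz]].
      by rewrite km_ef; case: ifP => _; [exists (km_coroot g i')|exists 0; rewrite linear0].
    by eexists; exact: wz.
  rewrite lieC km_he -scaleNr; apply: lspanZ; apply: lspan_gen; left.
  exact: monomial1.
have SF i : S (km_f g i).
  move=> y; apply: lspan_br => {}y [ye|[yf|[h _ <-]]].
  - apply: (@lspan_sub (monomial (km_e g) `|` range (km_in g))).
      by move=> z [Pz|Pz]; apply: lspan_gen; [left|right; right].
    apply: bracket_monomial ye => [i' j|h z /monomial_e_weight[n wz]].
      rewrite lieC km_ef; case: ifP => _; last by exists 0; rewrite oppr0 linear0.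
      by exists (- km_coroot g j); rewrite linearN.
    by eexists; exact: wz.
  - by apply: lspan_gen; right; left; exact: monomialM.
  rewrite lieC km_hf -scaleNr; apply: lspanZ; apply: lspan_gen; right; left.
  exact: monomial1.
have SH h : S (km_in g h).
  move=> y; apply: lspan_br => {}y [ye|[yf|[h' _ <-]]].
  - have [n wy] := monomial_e_weight ye; rewrite wy.
    by apply: lspanZ; apply: lspan_gen; left.
  - have [n wy] := monomial_f_weight yf; rewrite wy.
    by apply: lspanZ; apply: lspan_gen; right; left.
  by rewrite km_hh; exact: lspan0.
have SS : lie_subalgebra S.
  split; [split|].
  - by move=> y _; rewrite lie0l; exact: lspan0.
  - move=> a u v Su Sv y Py; rewrite lieDl lieZl.
    by apply: lspan_add; [apply: lspanZ; exact: Su|exact: Sv].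
  move=> u v Su Sv y Py.
  have -> : br (br u v) y = br u (br v y) + (-1) *: br v (br u y).
    by rewrite lie_leibniz scaleN1r addrK.
  by apply: lspan_add; [|apply: lspanZ]; [apply/Su/Sv|apply/Sv/Su].
have ST := km_generated SS SH SE SF.
suff -> : lspan P = setT by [].
apply: (@km_generated _ _ _ g).
- split; [split|].
  + exact: lspan0.
  + by move=> a u v Pu Pv; apply: lspan_add => //; exact: lspanZ.
  + by move=> u v _ Pv; have Su : S u by [rewrite ST]; exact: Su.
- by move=> h; apply: lspan_gen; right; right; exists h.
- by move=> i; apply: lspan_gen; left; exact: monomial1.
- by move=> i; apply: lspan_gen; right; left; exact: monomial1.
Qed.

(** The triangular decomposition writes a root vector as a sum of vectors whose weights have a
    constant sign. If [n] had both signs, none of these weights would equal [n], and independence of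
    weights would make the root vector zero. *)
Lemma km_root_sign n : km_is_root g n ->
  (forall i, 0 <= n i) \/ (forall i, n i <= 0).
Proof.
move=> [_ [x x0 wx]]; apply: contrapT => /not_orP[/existsNP[i ni] /existsNP[j nj]].
move/eqP: x0; apply.
have [l [xE lP]] : exists l : seq ((I -> int) * g), x = \sum_(y <- l) y.2 /\
    forall y, List.In y l -> of_weight y.1 y.2 /\ ~ (y.1 =1 n).
  elim: (triangular_decomposition x) => [|k {wx}x' y Px _ [l [-> lP]]].
    by exists [::]; rewrite big_nil.
  have [n' [wx' nn']] : exists n', of_weight n' x' /\ ~ n' =1 n.
    case: Px => [/monomial_e_weight[m wm]|[/monomial_f_weight[m wm]|[h _ <-]]].
    - by eexists; split; [exact: wm|] => e; apply: ni; rewrite -e mul1r.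
    - by eexists; split; [exact: wm|] => e; apply: nj; rewrite -e mulN1r oppr_le0.
    - exists (fun=> 0); split; last by move=> e; apply: ni; rewrite -e.
      by move=> h'; rewrite km_hh /weight big1 ?scale0r.
  exists ((n', k *: x') :: l); rewrite big_cons; split=> // z [<-|/lP//].
  by split=> //; exact: of_weightZ.
exact: weight_independent wx xE lP.
Qed.
End KacMoodyRoots.

(** * Order convexity of enclosures *)

Section RootOrder.
Context (R : realType) (V : vectType R) (I : finType).
Variables (D : vectorial_data V I) (AA : model_apartment D).
Local Notation al := (al D).

Lemma imaginary_root_signed a : imaginary_root D a -> signed D a.
Proof.
move=> [g [n [gn aE _]]].
have av v : (a v : R) = \sum_i (n i)%:~R * al i v.
  rewrite aE sum_lfunE; apply: eq_bigr => i _.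
  by rewrite -scaler_int scale_lfunE.
case: (km_root_sign gn) => ns; [left|right] => v dv; rewrite av.
  by apply: sumr_ge0 => i _; rewrite mulr_ge0 ?ler0z.
by apply: sumr_le0 => i _; rewrite mulr_le0_ge0 ?lerz0.
Qed.

Lemma root_signed a : (real_root D `|` imaginary_root D) a -> signed D a.
Proof. by case; [exact: real_root_signed|exact: imaginary_root_signed]. Qed.

Definition sle (s : bool) (u v : V) : Prop :=
  forall i, 0 <= (-1) ^+ s * al i (v - u).

(** A root of constant sign on the dominant cone is monotone for the order, so its value at [v] is
    bounded below by its value at [p] or at [q]. Reversing the order only exchanges [p] and [q]. *)
Lemma root_intersection_convex (k : 'Hom(V, R^o) -> \bar R) s p v q :
  root_intersection D k p -> root_intersection D k q ->
  sle s p v -> sle s v q -> root_intersection D k v.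
Proof.
wlog -> : s p q / s = false => [H kp kq pv vq|kp kq pv vq a ra].
  case: s pv vq => pv vq; last exact: (H false p q).
  by apply: (H false q p) => // i; [have := vq i|have := pv i];
    rewrite !expr0 !expr1 !mul1r mulN1r -alN opprB.
have mono u w : sle false u w -> dominant D (w - u).
  by move=> h i; have := h i; rewrite mul1r.
have := kp a ra; have := kq a ra; rewrite /half_space /=.
case: (k a) => [r| |] //; rewrite -!EFinD !lee_fin.
have aB u w : (a (w - u) : R) = a w - a u by exact: linearB.
case: (root_signed ra) => h.
  by have := h _ (mono _ _ pv); rewrite aB; lra.
by have := h _ (mono _ _ vq); rewrite aB; lra.
Qed.
End RootOrder.

(** * The dominance order *)

(** Real induction: the infimum of the points where [P] fails would satisfy [P] by the hypothesis on
    left limits, and then the hypothesis on extension to the right pushes all failures strictly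
    beyond it. *)
Lemma interval_induction (R : realType) (P : R -> Prop) : P 0 ->
  (forall t, 0 <= t < 1 -> (forall u, 0 <= u <= t -> P u) ->
     exists2 e, 0 < e & forall u, t <= u <= t + e -> u <= 1 -> P u) ->
  (forall t, 0 < t <= 1 -> (forall u, 0 <= u < t -> P u) -> P t) ->
  forall t, 0 <= t <= 1 -> P t.
Proof.
move=> P0 Pr Pl t0 t01; apply: contrapT => nPt0.
pose N := [set t : R | 0 <= t <= 1 /\ ~ P t].
have N0 : N !=set0 by exists t0.
have Nlb : lbound N 0 by move=> t [/andP[]].
have hN : has_lbound N by exists 0.
set tau := inf N.
have tau0 : 0 <= tau by exact: lb_le_inf.
have taut0 : tau <= t0 by apply: ge_inf.
have [t00 t01'] := andP t01.
have tau1 : tau <= 1 by exact: le_trans taut0 t01'.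
have Plt u : 0 <= u < tau -> P u.
  move=> /andP[u0 ut]; apply: contrapT => nPu; move: (ut); rewrite ltNge => /negP; apply.
  by apply: ge_inf => //; split=> //; rewrite u0 /=; lra.
have Ptau : P tau.
  have [tau_gt0|] := ltP 0 tau; first by apply: Pl => //; rewrite tau_gt0.
  by move=> ?; have -> : tau = 0 by lra.
have Ple u : 0 <= u <= tau -> P u.
  move=> /andP[u0]; rewrite le_eqVlt => /orP[/eqP->//|ut].
  by apply: Plt; rewrite u0.
have tau_lt1 : tau < 1.
  rewrite lt_neqAle tau1 andbT; apply/eqP => tauE; apply: nPt0.
  by have -> : t0 = tau by lra.
have [|e e0 He] := Pr tau _ Ple; first by rewrite tau0.
have : tau + e <= tau; last by lra.
apply: lb_le_inf => // t [/andP[h0 h1] nPt]; rewrite leNgt; apply/negP => h.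
apply: nPt; have [htau|htau] := leP t tau; first by apply: Ple; rewrite h0.
by apply: He => //; apply/andP; split; lra.
Qed.

Section Dominance.
Context (R : realType) (V : vectType R) (I : finType).
Variables (D : vectorial_data V I).
Local Notation al := (al D).
Local Notation act := (act D).
Local Notation slt := (slt D).
Local Notation sle := (sle D).

Lemma sltW s u v : slt s u v -> sle s u v.
Proof. by move=> h i; exact: ltW. Qed.

Lemma sle_refl s u : sle s u u.
Proof. by move=> i; rewrite subrr al0 mulr0. Qed.

Lemma sle_trans s v u w : sle s u v -> sle s v w -> sle s u w.
Proof.
move=> h h' i; have := h i; have := h' i; rewrite -(subrKA v w (- u)) (alD D i (w - v)) mulrDr.
exact: addr_ge0.
Qed.

Lemma slt_le_trans s v u w : slt s u v -> sle s v w -> slt s u w.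
Proof.
move=> h h' i; have := h i; have := h' i; rewrite -(subrKA v w (- u)) (alD D i (w - v)) mulrDr.
by move=> a b; rewrite ltr_wpDl.
Qed.

Lemma sle_lt_trans s v u w : sle s u v -> slt s v w -> slt s u w.
Proof.
move=> h h' i; have := h i; have := h' i; rewrite -(subrKA v w (- u)) (alD D i (w - v)) mulrDr.
by move=> a b; rewrite ltr_wpDr.
Qed.

Lemma slt_trans s v u w : slt s u v -> slt s v w -> slt s u w.
Proof. by move=> h /sltW; exact: slt_le_trans. Qed.

Lemma slt_sub s u v : slt s u v <-> slt s 0 (v - u).
Proof. by split=> h i; have := h i; rewrite subr0. Qed.

Lemma slt_negb s u v : slt s u v <-> slt (~~ s) v u.
Proof.
have e i : (-1) ^+ s * al i (v - u) = (-1) ^+ (~~ s) * al i (u - v).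
  by rewrite -opprB alN signrN mulNr mulrN.
by split=> h i; have := h i; rewrite e.
Qed.

Lemma slt_shift s n u v : slt s u v -> slt s (n + u) (n + v).
Proof. by move=> h i; rewrite opprD addrACA subrr add0r; exact: h. Qed.

Lemma slt_opp s d : slt s 0 d -> slt (~~ s) 0 (- d).
Proof.
by move=> h i; have := h i; rewrite !subr0 alN signrN mulrN mulNr opprK.
Qed.

Lemma sltZ s k d : 0 < k -> slt s 0 d -> slt s 0 (k *: d).
Proof.
by move=> k0 h i; have := h i; rewrite !subr0 alZ mulrCA => ?; rewrite mulr_gt0.
Qed.

Lemma slt_line s u d t t' : slt s 0 d -> t < t' -> slt s (u + t *: d) (u + t' *: d).
Proof.
move=> h tt; apply/slt_sub; rewrite opprD addrACA subrr add0r -scalerBl.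
by apply: sltZ => //; rewrite subr_gt0.
Qed.

Lemma sle_line s u d t t' : slt s 0 d -> t <= t' -> sle s (u + t *: d) (u + t' *: d).
Proof.
rewrite le_eqVlt => h /orP[/eqP->|tt]; first exact: sle_refl.
by apply: sltW; exact: slt_line.
Qed.

Lemma slt_neq0 s d : slt s 0 d -> d != 0.
Proof.
have /card_gt0P[i _] := index_nonempty D.
by move=> /(_ i); rewrite subr0; apply: contraTneq => ->; rewrite al0 mulr0 ltxx.
Qed.

Lemma slt_small s d v : slt s 0 d ->
  exists2 e, 0 < e & forall t, 0 <= t <= e -> slt s (t *: v) d.
Proof.
move=> dr.
have d0 i : 0 < (-1) ^+ s * al i d by have := dr i; rewrite subr0.
(* For every [i], [c i] bounds the size of $\alpha_i(v)$ relative to $\alpha_i(d)$; the inverse of 1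
   plus their sum works for all [i] at once, with strict inequality. *)
pose c i := `|al i v| / ((-1) ^+ s * al i d).
have c0 i : 0 <= c i by rewrite divr_ge0 // ltW.
have S0 : 0 <= \sum_i c i by exact: sumr_ge0.
exists (1 + \sum_i c i)^-1; first by rewrite invr_gt0; lra.
move=> t /andP[t0 te] i; rewrite alB alZ mulrBr subr_gt0.
have Sp : 0 < 1 + \sum_i c i by lra.
have tS : t * (1 + \sum_i c i) <= 1 by rewrite -ler_pdivlMr // mul1r.
have cS : c i <= \sum_i c i.
  by rewrite (bigD1 i) //= lerDl; apply: sumr_ge0.
have cE : `|al i v| = c i * ((-1) ^+ s * al i d) by rewrite divfK // gt_eqF.
apply: le_lt_trans (_ : t * `|al i v| < _).
  by rewrite mulrCA ler_wpM2l // (le_trans (ler_norm _)) // normrM normr_sign mul1r.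
rewrite cE mulrA gtr_pMl //.
have [->|tn0] := eqVneq t 0; first by rewrite mul0r.
apply: lt_le_trans tS; rewrite ltr_pM2l; first by lra.
by rewrite lt_neqAle eq_sym tn0.
Qed.

Lemma slt_approach s a m w : slt s w m ->
  exists2 e, 0 < e & forall t, 1 - e <= t <= 1 -> slt s w (a + t *: (m - a)).
Proof.
move=> /slt_sub wm; have [e e0 He] := slt_small (m - a) wm.
exists e => // t /andP[te t1]; apply/slt_sub.
have key (x : V) : a + t *: x - w = (x + a - w) - (1 - t) *: x.
  by rewrite scalerBl scale1r opprB [RHS]addrC -!addrA addKr; exact: addrCA.
by rewrite key subrK; apply: (proj1 (slt_sub _ _ _)); apply: He; lra.
Qed.

Lemma slt_large s d u v : slt s 0 d ->
  exists2 T, 0 < T & forall t, T <= t -> slt s v (u + t *: d).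
Proof.
move=> dr; have [e e0 He] := slt_small (v - u) dr.
exists e^-1; first by rewrite invr_gt0.
move=> t tT.
have t0 : 0 < t by apply: lt_le_trans tT; rewrite invr_gt0.
have /(_ _)/slt_sub := He t^-1; rewrite invr_ge0 (ltW t0) /= -[e]invrK lef_pV2 ?posrE ?invr_gt0 //.
move=> /(_ tT) /(sltZ t0); rewrite scalerBr scalerA divff ?gt_eqF // scale1r => h.
by apply/slt_sub; rewrite addrAC addrC -opprB.
Qed.

Lemma sle_bound s d u v : slt s 0 d -> exists w, slt s u w /\ slt s v w.
Proof.
move=> dr; have [T _ HT] := slt_large 0 u dr; have [T' _ HT'] := slt_large 0 v dr.
by exists (0 + Num.max T T' *: d); split; [apply: HT|apply: HT']; rewrite le_max lexx ?orbT.
Qed.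

Lemma act_id s t u v : slt s 0 u -> slt s 0 v -> act t u = v -> act t =1 id.
Proof. by move=> ur vr E; apply: act_regular ur _; rewrite E. Qed.

Lemma vface_chamber s v : vface D s \1%VF set0 v <-> slt s 0 v.
Proof.
split=> [[u [_ ur] <-] i|vr].
  by rewrite id_lfunE subr0 alZ mulrA -expr2 sqrr_sign mul1r; exact: ur.
exists ((-1) ^+ s *: v); last by rewrite id_lfunE scalerA -expr2 sqrr_sign scale1r.
by split=> [i []|i _]; have := vr i; rewrite subr0 -alZ.
Qed.

Lemma spherical_set0 : spherical D set0.
Proof.
apply: (@sub_finite_set _ _ [set \1%VF]); last exact: finite_set1.
by move=> w; elim=> [|i w' []].
Qed.

Lemma vlt_slt u v : slt false u v -> vlt D u v.
Proof.
move=> uv; exists \1%VF, set0; split; [exact: weyl1|exact: spherical_set0|].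
by apply/vface_chamber; move/slt_sub: uv.
Qed.

Lemma vle_refl u : vle D u u.
Proof.
exists \1%VF, setT; split; first exact: weyl1.
exists 0; last by rewrite linear0 scaler0 subrr.
by split=> [i _|i []//]; rewrite linear0.
Qed.

Lemma slt_preordered s u v : slt s u v -> preordered D u v.
Proof.
have h u' v' : slt false u' v' -> vle D u' v'.
  by move=> /vlt_slt[w [J [? _ ?]]]; exists w, J.
by case: s => [/slt_negb|] /h; [right|left].
Qed.

Lemma slt_generic s d : slt s 0 d -> generic_line D (half_line d).
Proof.
move=> dr; exists d; split=> //; first exact: slt_neq0 dr.
by case: s dr => [/slt_negb|] /vlt_slt; [right|left].
Qed.

(** Restricting the neighbourhood in a germ to a line through its base point gives an interval of
    parameters; this is the only use made of the topology of [V]. *)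
Lemma germ_along m d (S T : set V) : germ m S T ->
  (forall t, 0 < t <= 1 -> S (m + t *: d)) ->
  exists2 e, 0 < e <= 1 & forall t, 0 < t <= e -> T (m + t *: d).
Proof.
move=> gST Sd.
have lim : v2r m + t *: v2r d @[t --> (0 : R)] --> v2r m.
  rewrite -[X in _ --> X]addr0 -(scale0r (v2r d)).
  by apply: cvgD; [exact: cvg_cst|apply: cvgZr_tmp; exact: cvg_id].
have /nbhs_ballP[e /= e0 He] := lim _ gST.
exists (Num.min 1 (e / 2)).
  by rewrite lt_min ge_min lexx /= andbT; apply/andP; split; lra.
move=> t /andP[t0]; rewrite le_min => /andP[t1 te].
have := He t; rewrite /ball /= sub0r normrN gtr0_norm //.
rewrite !linearD !linearZ /= !v2rK; apply; first by lra.
by apply: Sd; rewrite t0.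
Qed.

(** Closedness is checked one root at a time, so the number of roots does not matter. It recovers
    the endpoint of a segment, which the germ of a half-open segment leaves out. *)
Lemma root_intersection_limit (k : 'Hom(V, R^o) -> \bar R) m d e : 0 < e ->
  (forall t, 0 < t <= e -> root_intersection D k (m + t *: d)) ->
  root_intersection D k m.
Proof.
move=> e0 He a ra; have {}He t te := He t te a ra.
move: He; rewrite /half_space /=; case: (k a) => [r| |] He //.
  have {}He t : 0 < t <= e -> 0 <= (a m : R) + t * a d + r.
    by move=> /He; rewrite linearD linearZ -EFinD lee_fin.
  rewrite -EFinD lee_fin leNgt; apply/negP => h.
  have [ad|ad] := leP (a d : R) 0.
    have := He e; rewrite e0 lexx => /(_ isT).
    by have := mulr_ge0_le0 (ltW e0) ad; lra.
  (* With this [t] the root gains at most half of what it lacks at [m], so it is still negative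
     there. *)
  pose t := Num.min e (- ((a m : R) + r) / a d / 2).
  have c0 : 0 < - ((a m : R) + r) / a d / 2 by rewrite !divr_gt0 // oppr_gt0.
  have t0 : 0 < t by rewrite lt_min e0.
  have := He t; rewrite t0 ge_min lexx /= => /(_ isT).
  have : t * a d <= - ((a m : R) + r) / 2.
    rewrite -ler_pdivlMr // mulrAC /t ge_min; apply/orP; right.
    by rewrite le_eqVlt; apply/orP; left; apply/eqP.
  lra.
all: by have := He e; rewrite e0 lexx => /(_ isT).
Qed.

End Dominance.

(** * Charts *)

Section Charts.
Context (R : realType) (V : vectType R) (I : finType).
Variables (D : vectorial_data V I) (AA : model_apartment D) (Delta : Type).
Variables (S : apartment_system V Delta) (HS : is_hovel AA S).
Local Notation slt := (slt D).
Local Notation sle := (sle D).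

Definition is_chart (A : set Delta) (f : V -> Delta) : Prop :=
  apt S A /\ chart S A f.

Lemma apt_chart A : apt S A -> exists f, is_chart A f.
Proof.
move=> aA; have [f0 _ E] := hovel_MA1 HS aA.
by exists f0; split; rewrite // E; exists id => //; exact: affine_weyl1.
Qed.

Lemma chart_bij A f : is_chart A f ->
  [/\ injective f, (forall v, A (f v)) & forall z, A z -> exists v, f v = z].
Proof.
move=> [aA]; have [f0 [f0A f0i f0s] ->] := hovel_MA1 HS aA.
move=> [w /Wa_inv[w' [_ ww' w'w]] <-]; split=> [u v /= E|v|z Az].
- by apply: (can_inj ww'); apply: f0i E; exact: in_setT.
- exact: f0A.
by have [v _ <-] := f0s _ Az; exists (w' v); rewrite /= w'w.
Qed.

Lemma chart_inj A f : is_chart A f -> injective f.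
Proof. by move=> /chart_bij[]. Qed.
Lemma chart_im A f : is_chart A f -> forall v, A (f v).
Proof. by move=> /chart_bij[]. Qed.
Lemma chart_surj A f : is_chart A f -> forall z, A z -> exists v, f v = z.
Proof. by move=> /chart_bij[]. Qed.

Lemma chart_comp A f w : is_chart A f -> Wa AA w -> is_chart A (f \o w).
Proof.
move=> [aA cf] Ww; split=> //; move: cf.
have [f0 _ ->] := hovel_MA1 HS aA => -[w0 Ww0 <-].
by exists (w0 \o w) => //; exact: Wa_comp.
Qed.

Lemma chart_change A f g : is_chart A f -> is_chart A g ->
  exists2 w, Wa AA w & g = f \o w.
Proof.
move=> [aA]; have [f0 _ E] := hovel_MA1 HS aA; rewrite E.
move=> [w1 Ww1 <-] [_]; rewrite E => -[w2 Ww2 <-].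
have [w1' [Ww1' _ w1K]] := Wa_inv Ww1.
exists (w1' \o w2); first exact: Wa_comp.
by apply/funext => v /=; rewrite w1K.
Qed.

(* [v] and [v'] may differ: this also excludes foldings of a straight path. *)
Lemma chart_rigid A f g s u v v' : is_chart A f -> is_chart A g ->
  f u = g u -> f v = g v' -> slt s u v -> slt s u v' -> f = g.
Proof.
move=> cf cg fu fv uv uv'; have [w Ww gE] := chart_change cf cg.
have [t wt] := Wa_linear Ww.
have wu : w u = u by apply: (chart_inj cf); rewrite fu gE.
have wv : w v' = v by apply: (chart_inj cf); rewrite fv gE.
have tid : act D t =1 id.
  apply: (@act_id _ _ _ D s t (v' - u) (v - u)); [by move/slt_sub: uv'|by move/slt_sub: uv|].
  by rewrite -wt wu wv.
rewrite gE; apply/funext => x /=.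
by have /eqP := wt u x; rewrite tid wu subr_eq subrK => /eqP ->.
Qed.

(** (MA2) in terms of charts: composing a chart of [A'] with the element of $W^a$ that represents
    the Weyl-isomorphism turns the isomorphism into literal agreement of two charts. *)
Lemma chart_share A f A' F : is_chart A f -> apt S A' -> MA2_filter AA F ->
  F (f @^-1` A') -> exists g k, [/\ is_chart A' g, F (root_intersection D k) &
    forall v, root_intersection D k v -> f v = g v].
Proof.
move=> cf aA' mF FA'.
have [aA cf'] := cf.
have [_ [phi [_ wphi] [X [k [_ kF kX]] Xphi]]] :=
  hovel_MA2 HS aA aA' cf' mF FA' cf'.
have [f' [_ cfA']] := apt_chart aA'.
have [w Ww E] := wphi _ _ cf' cfA'.
exists (f' \o w), k; split.
- exact: chart_comp.
- move: kF; rewrite /pull /=; congr F.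
  by rewrite eqEsubset; split=> v; [move=> [x kx /(chart_inj cf) <-]|exists v].
by move=> v kv; rewrite -[LHS]Xphi ?E //; exact: kX.
Qed.

Lemma vsegmentC u v : @vsegment R V u v = vsegment v u.
Proof.
by rewrite eqEsubset; split=> _ [t /andP[t0 t1] <-]; exists (1 - t);
  rewrite /= ?subr_ge0 ?t1 ?lerBlDr ?lerDl // scalerBl scale1r addrA addrC
  [_ + (_ - _)]addrC subrK -scalerN opprB addrC.
Qed.

Lemma segment_eq A A' f f' a b a' b' : is_chart A f -> is_chart A' f' ->
  f a = f' a' -> f b = f' b' -> preordered D a b ->
  f @` vsegment a b = f' @` vsegment a' b'.
Proof.
move=> [aA cf] [aA' cf'] ea eb [ab|ba].
  exact: (hovel_MAO HS aA aA' cf cf').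
by rewrite [vsegment a b]vsegmentC [vsegment a' b']vsegmentC; exact: (hovel_MAO HS aA aA' cf cf').
Qed.

Lemma segment_in A A' f a b t : is_chart A f -> apt S A' -> preordered D a b ->
  A' (f a) -> A' (f b) -> 0 <= t <= 1 -> A' (f (a + t *: (b - a))).
Proof.
move=> cf aA' ab fa fb t01; have [g cg] := apt_chart aA'.
have [a' ga] := chart_surj cg fa; have [b' gb] := chart_surj cg fb.
have : (f @` vsegment a b) (f (a + t *: (b - a))).
  by exists (a + t *: (b - a)) => //; exists t.
rewrite (segment_eq cf cg (esym ga) (esym gb) ab) => -[x _ <-].
exact: chart_im cg _.
Qed.

(** (MA2) for the germ of a segment makes two charts agree on an enclosure of that germ. This
    enclosure contains a short initial segment and [p] by closedness, hence by convexity a whole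
    order interval. *)
Lemma chart_box A f A' s p d : is_chart A f -> apt S A' -> slt s 0 d ->
  (forall t, 0 < t <= 1 -> A' (f (p + t *: d))) ->
  exists g e, [/\ is_chart A' g, 0 < e &
    forall v, sle s p v -> sle s v (p + e *: d) -> f v = g v].
Proof.
move=> cf aA' dr Hd.
have ppd : slt s p (p + d) by apply/slt_sub; rewrite addrAC subrr add0r.
have [|| g [k [cg kF kE]]] :=
  @chart_share A f A' (germ p (vsegment_oc p (p + d))) cf aA'.
- constructor 2; exists p, (p + d); split=> //; last exact: slt_preordered ppd.
  by rewrite -subr_eq0 opprD addrA subrr add0r oppr_eq0 (slt_neq0 dr).
- apply: (@filterE _ (nbhs (v2r p))) => y [t /= t01 <-]; rewrite addrAC subrr add0r; exact: Hd.
have [|e /andP[e0 _] He] := germ_along (d := d) kF.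
  by move=> t t01; exists t => //; rewrite addrAC subrr add0r.
exists g, e; split=> // v pv vp; apply: kE.
apply: root_intersection_convex pv vp; last by apply: He; rewrite e0 lexx.
exact: root_intersection_limit He.
Qed.

(** By (MAO) the segment lies in [A'], but pointwise agreement is needed. Real induction along it
    glues the charts given by small boxes, and rigidity identifies each of them with the first
    one. *)
Lemma chart_segment A f A' s p q : is_chart A f -> apt S A' -> slt s p q ->
  A' (f p) -> A' (f q) -> exists g, is_chart A' g /\
    forall t, 0 <= t <= 1 -> f (p + t *: (q - p)) = g (p + t *: (q - p)).
Proof.
move=> cf aA' pq Ap Aq; set d := q - p.
have dr : slt s 0 d by move/slt_sub: pq.
have Ad t : 0 <= t <= 1 -> A' (f (p + t *: d)).
  exact: segment_in cf aA' (slt_preordered pq) Ap Aq.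
have boxr t : 0 <= t < 1 -> exists g e, [/\ is_chart A' g, 0 < e &
    forall u, t <= u <= t + e -> f (p + u *: d) = g (p + u *: d)].
  move=> /andP[t0 t1]; have t1' : 0 < 1 - t by rewrite subr_gt0.
  have [|g [e [cg e0 He]]] := chart_box (p := p + t *: d) cf aA' (sltZ t1' dr).
    move=> u /andP[u0 u1]; rewrite scalerA -addrA -scalerDl; apply: Ad.
    apply/andP; split; nra.
  exists g, (e * (1 - t)); split=> //; first exact: mulr_gt0.
  move=> u /andP[tu ut]; apply: He; first exact: sle_line.
  by rewrite scalerA -addrA -scalerDl; exact: sle_line.
have boxl t : 0 < t <= 1 -> exists g e, [/\ is_chart A' g, 0 < e &
    forall u, t - e <= u <= t -> f (p + u *: d) = g (p + u *: d)].
  move=> /andP[t0 t1].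
  have dr' := slt_opp dr.
  have [|g [e [cg e0 He]]] := chart_box (p := p + t *: d) cf aA' (sltZ t0 dr').
    move=> u /andP[u0 u1]; rewrite scalerA scalerN -scaleNr -addrA -scalerDl.
    by apply: Ad; apply/andP; split; nra.
  exists g, (e * t); split=> //; first exact: mulr_gt0.
  have neg (x y : R) : y <= x -> sle (~~ s) (p + x *: d) (p + y *: d).
    have e' z : z *: d = (- z) *: (- d) by rewrite scalerN scaleNr opprK.
    by move=> yx; rewrite !e'; apply: sle_line => //; rewrite lerN2.
  move=> u /andP[tu ut]; apply: He; first exact: neg.
  by rewrite scalerA scalerN -scaleNr -addrA -scalerDl; exact: neg.
have [|g [e0 [cg e00 He0]]] := boxr 0; first by rewrite lexx ltr01.
exists g; split=> // t t01.
pose P u := f (p + u *: d) = g (p + u *: d).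
apply: (@interval_induction _ P) t01; rewrite /P.
- by apply: He0; rewrite lexx add0r ltW.
- move=> {}t /andP[t0 t1] Pt.
  move: t0; rewrite le_eqVlt => /orP[/eqP<-|t0].
    by exists e0 => // u ut _; apply: He0.
  have [|g' [e [cg' epos He]]] := boxr t; first by rewrite (ltW t0).
  exists (Num.min e (1 - t)); first by rewrite lt_min epos subr_gt0.
  suff -> : g = g'.
    move=> u /andP[tu]; rewrite -lerBlDl le_min => /andP[ue _] _.
    by apply: He; rewrite tu -lerBlDl.
  pose e1 := Num.min e (1 - t).
  have e1pos : 0 < e1 by rewrite lt_min epos subr_gt0.
  have e1e : e1 <= e by rewrite ge_min lexx.
  have e1t : e1 <= 1 - t by rewrite ge_min lexx orbT.
  have gt : f (p + t *: d) = g (p + t *: d) by apply: Pt; rewrite lexx ltW.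
  have gp : f p = g p.
    by have := Pt 0; rewrite scale0r addr0; apply; rewrite lexx ltW.
  (* [b] is where [g] places the point at parameter [t + e1] of [f]. By (MAO) the segment from [p]
     to [b] passes through parameter [t], so [b] lies strictly beyond it on the same line, and
     rigidity applies to [g] and [g']. *)
  have [|b gb] := chart_surj cg (Ad (t + e1) _); first by apply/andP; split; lra.
  have pq' : slt s p (p + (t + e1) *: d).
    by rewrite -{1}[p]addr0 -(scale0r d); apply: slt_line => //; lra.
  have := segment_eq cf cg gp (esym gb) (slt_preordered pq').
  move=> /(congr1 (fun X => X (f (p + t *: d)))) Eseg.
  have : (f @` vsegment p (p + (t + e1) *: d)) (f (p + t *: d)).
    exists (p + t *: d) => //; exists (t / (t + e1)).
      by rewrite /= divr_ge0 ?ler_pdivrMr ?mul1r; lra.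
    by rewrite addrAC subrr add0r scalerA divfK //; lra.
  rewrite Eseg gt => -[_ [r /= /andP[r0 r1] <-]] /(chart_inj cg) /addrI rb.
  have {}r0 : 0 < r.
    rewrite lt_neqAle r0 andbT eq_sym; apply/negP => /eqP rE.
    move: rb; rewrite rE scale0r => /esym/eqP; rewrite scaler_eq0.
    by rewrite (negPf (slt_neq0 dr)) gt_eqF.
  have bE : b = p + (t / r) *: d.
    by rewrite mulrC -scalerA -rb scalerA mulVf ?gt_eqF // scale1r addrC subrK.
  have tr : t < t / r.
    rewrite lt_neqAle; apply/andP; split; last by rewrite ler_pdivlMr // ler_piMr // ltW.
    apply/eqP => tE; move: gb; rewrite bE -tE -gt => /(chart_inj cf) /addrI /eqP.
    rewrite -subr_eq0 -scalerBl scaler_eq0 (negPf (slt_neq0 dr)) orbF; lra.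
  apply: (@chart_rigid A' g g' s (p + t *: d) b (p + (t + e1) *: d)) => //.
  - by rewrite -gt; apply: He; lra.
  - by rewrite gb; apply: He; lra.
  - by rewrite bE; exact: slt_line.
  - by apply: slt_line => //; lra.
move=> {}t t01 Pt; have [g' [e [cg' epos He]]] := boxl t t01.
suff -> : g = g' by apply: He; lra.
(* At the left limit, [g] and [g'] both agree with [f] just below [t]; two distinct points in that
   range are enough for rigidity. The bound [t / 3] keeps the range among nonnegative parameters. *)
pose u1 := Num.max (t / 3) (t - e / 2).
have u1t : t / 3 <= u1 by rewrite le_max lexx.
have u1e : t - e / 2 <= u1 by rewrite le_max lexx orbT.
have u1l : u1 < t by rewrite gt_max; lra.
have h u : u1 <= u < t -> g (p + u *: d) = g' (p + u *: d).
  by move=> ut; rewrite -Pt; [apply: He|]; lra.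
have u2 : u1 < (u1 + t) / 2 by lra.
apply: (@chart_rigid A' g g' s (p + u1 *: d) (p + (u1 + t) / 2 *: d)
   (p + (u1 + t) / 2 *: d)) => //; try exact: slt_line.
  by apply: h; lra.
by apply: h; lra.
Qed.

End Charts.

(** * Agreement of charts on order intervals and sectors *)

Section Germs.
Context (R : realType) (V : vectType R) (I : finType).
Variables (D : vectorial_data V I) (AA : model_apartment D) (Delta : Type).
Variables (S : apartment_system V Delta) (HS : is_hovel AA S).
Local Notation slt := (slt D).
Local Notation sle := (sle D).
Local Notation is_chart := (is_chart S).

(** Real induction along the segment from [p] to [v]. Each point reached lies in [A'] and strictly
    below [q], so its segment to [q] is shared as well, and the box around the start of that segment
    contains the next piece of the path to [v]. *)
Lemma chart_interval A f A' s p q : is_chart A f -> apt S A' -> slt s p q ->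
  A' (f p) -> A' (f q) -> exists g, [/\ is_chart A' g,
    forall t, 0 <= t <= 1 -> f (p + t *: (q - p)) = g (p + t *: (q - p)) &
    forall v, slt s p v -> slt s v q -> f v = g v].
Proof.
move=> cf aA' pq Ap Aq; have [g [cg Hg]] := chart_segment HS cf aA' pq Ap Aq.
exists g; split=> // v pv vq; set d := v - p.
have dr : slt s 0 d by move/slt_sub: pv.
have gp : f p = g p by have := Hg 0; rewrite scale0r addr0; apply; lra.
have gq : f q = g q by have := Hg 1; rewrite scale1r addrC subrK; apply; lra.
have vE : v = p + 1 *: d by rewrite scale1r /d addrC subrK.
suff H t : 0 <= t <= 1 -> f (p + t *: d) = g (p + t *: d).
  by have := H 1; rewrite scale1r /d addrC subrK; apply; lra.
apply: (@interval_induction _ (fun t => f (p + t *: d) = g (p + t *: d))).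
- by rewrite scale0r addr0.
- move=> {}t /andP[t0 t1] Pt; set n := p + t *: d.
  have fn : f n = g n by apply: Pt; rewrite t0 lexx.
  have An : A' (f n) by rewrite fn; exact (chart_im HS cg _).
  have nq : slt s n q.
    by apply: (slt_trans _ vq); rewrite [X in slt _ _ X]vE; exact: slt_line.
  have [g1 [cg1 Hg1]] := chart_segment HS cf aA' nq An Aq.
  have [|h [e [ch e0 He]]] := chart_box (p := n) HS cf aA' (proj1 (slt_sub _ _ _ _) nq).
    move=> u /andP[u0 u1]; rewrite Hg1; first exact (chart_im HS cg1 _).
    by rewrite (ltW u0).
  (* Rigidity at [n] and [q] shows that the chart shared along the segment from [n] to [q] is still
     [g]; the box chart [h] is then compared with it on that segment. *)
  have gE : g = g1.
    apply: (chart_rigid HS cg cg1 (u := n) (v := q) (v' := q) (s := s)) => //.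
      by rewrite -fn; have := Hg1 0; rewrite scale0r addr0; apply; lra.
    by rewrite -gq; have := Hg1 1; rewrite scale1r addrC subrK; apply; lra.
  have hE : g = h.
    pose e1 := Num.min e 1.
    have e10 : 0 < e1 by rewrite lt_min e0 ltr01.
    have e1e : e1 <= e by rewrite ge_min lexx.
    have e11 : e1 <= 1 by rewrite ge_min lexx orbT.
    have nqd := proj1 (slt_sub _ _ _ _) nq.
    have nE : sle s n (n + e *: (q - n)).
      by rewrite -{1}[n]addr0 -(scale0r (q - n)); apply: sle_line => //; exact: ltW.
    apply: (chart_rigid HS cg ch (u := n) (v := n + e1 *: (q - n))
      (v' := n + e1 *: (q - n)) (s := s)).
    - by rewrite -fn; apply: He => //; exact: sle_refl.
    - rewrite gE -Hg1; last lra.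
      apply: He; last exact: sle_line.
      by rewrite -{1}[n]addr0 -(scale0r (q - n)); apply: sle_line => //; exact: ltW.
    - by rewrite -{1}[n]addr0 -(scale0r (q - n)); apply: slt_line.
    - by rewrite -{1}[n]addr0 -(scale0r (q - n)); apply: slt_line.
  have nqd := proj1 (slt_sub _ _ _ _) nq.
  have [e' e'0 He'] := slt_small d (sltZ e0 nqd).
  exists e' => // u /andP[tu ut] _; rewrite hE; apply: He; first exact: sle_line.
  have -> : p + u *: d = n + (u - t) *: d by rewrite /n -addrA -scalerDl [t + _]addrC subrK.
  by apply/sltW/slt_shift; apply: He'; lra.
move=> {}t /andP[t0 t1] Pt; set n := p + t *: d.
(* At the left limit the box is taken backwards, from [n] towards [p]. *)
have dr' := slt_opp (sltZ t0 dr).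
have [|h [e [ch e0 He]]] := chart_box (p := n) HS cf aA' dr'.
  move=> u /andP[u0 u1]; rewrite scalerN scalerA -scaleNr -addrA -scalerDl Pt.
    exact (chart_im HS cg _).
  by apply/andP; split; nra.
suff gh : g = h by rewrite gh; apply: He; [exact: sle_refl|
  rewrite -{1}[n]addr0 -(scale0r (- (t *: d))); apply: sle_line => //; exact: ltW].
pose e1 := Num.min e 1.
have e10 : 0 < e1 by rewrite lt_min e0 ltr01.
have e1e : e1 <= e by rewrite ge_min lexx.
have e11 : e1 <= 1 by rewrite ge_min lexx orbT.
have h1 u : 0 < u <= e1 -> g (n + u *: - (t *: d)) = h (n + u *: - (t *: d)).
  move=> /andP[u0 ue]; rewrite -He.
  - rewrite scalerN scalerA -scaleNr -addrA -scalerDl Pt //.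
    by apply/andP; split; nra.
  - by rewrite -{1}[n]addr0 -(scale0r (- (t *: d))); apply: sle_line => //; exact: ltW.
  by apply: sle_line => //; lra.
have ll : e1 / 2 < e1 by lra.
apply: (chart_rigid HS cg ch (u := n + (e1 / 2) *: - (t *: d)) (v := n + e1 *: - (t *: d))
  (v' := n + e1 *: - (t *: d)) (s := ~~ s)); try exact: slt_line.
  by apply: h1; lra.
by apply: h1; lra.
Qed.

(** By convexity an enclosure that contains a ray in an open chamber contains the closed sector at
    its origin, since each point there lies below a far point of the ray. *)
Lemma chart_ray A f A' s u d : is_chart A f -> apt S A' -> slt s 0 d ->
  (forall t, 0 <= t -> A' (f (u + t *: d))) ->
  exists g, is_chart A' g /\ forall v, sle s u v -> f v = g v.
Proof.
move=> cf aA' dr Hd.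
have [|| g [k [cg kF kE]]] :=
  @chart_share _ _ _ _ _ _ _ HS A f A' (globally (vshift u (half_line d))) cf aA'.
- by constructor 3; exists u, (half_line d); split=> //; exact: slt_generic dr.
- by move=> _ [_ [t t0 <-] <-]; exact: Hd.
have kd t : 0 <= t -> root_intersection D k (u + t *: d).
  by move=> t0; apply: kF; exists (t *: d) => //; exists t.
exists g; split=> // v uv; apply: kE.
have [T T0 HT] := slt_large u v dr.
have ku : root_intersection D k u by have := kd 0; rewrite scale0r addr0; apply.
apply: (root_intersection_convex ku (kd _ (ltW T0)) uv).
by apply/sltW/HT.
Qed.

(** For [v] above [a], a point [w] above both [u] and [v] is common to the two charts. The order
    interval from [a] to [w] is then shared through some chart, which agrees with [g] at [w] and
    just before it, hence is [g]. *)
Lemma chart_agree A f A' g s u a b d : is_chart A f -> is_chart A' g ->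
  slt s 0 d -> (forall v, sle s u v -> f v = g v) -> f a = g b ->
  a = b /\ forall v, slt s a v -> f v = g v.
Proof.
move=> cf cg dr fg ab.
have main v : slt s a v -> f a = g a /\ f v = g v.
  move=> av.
  have [w [uw vw]] := sle_bound u v dr.
  have aw : slt s a w := slt_trans av vw.
  have fw : f w = g w by apply: fg; exact: sltW.
  have [g1 [cg1 Hg1 Hg2]] : exists g1, [/\ is_chart A' g1,
    forall t, 0 <= t <= 1 -> f (a + t *: (w - a)) = g1 (a + t *: (w - a)) &
    forall v, slt s a v -> slt s v w -> f v = g1 v].
    apply: chart_interval cf (proj1 cg) aw _ _; first by rewrite ab; exact (chart_im HS cg _).
    by rewrite fw; exact (chart_im HS cg _).
  have wE : a + 1 *: (w - a) = w by rewrite scale1r addrC subrK.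
  suff -> : g = g1.
    by split; [have := Hg1 0; rewrite scale0r addr0; apply; lra|exact: Hg2].
  have [e e0 He] := slt_approach a uw.
  pose r := Num.max 0 (1 - e).
  have r0 : 0 <= r by rewrite le_max lexx.
  have re : 1 - e <= r by rewrite le_max lexx orbT.
  have r1 : r < 1 by rewrite gt_max; lra.
  have rw : slt s (a + r *: (w - a)) w.
    by rewrite -[X in slt _ _ X]wE; apply: slt_line => //; move/slt_sub: aw.
  apply: (chart_rigid HS cg cg1 _ _ rw rw).
  - rewrite -Hg1; last lra.
    by apply/esym/fg/sltW/He; lra.
  - by rewrite -fw; have := Hg1 1; rewrite wE; apply; lra.
have [v [_ av]] := sle_bound a a dr.
split; last by move=> x /main[].
by apply: (chart_inj HS cg); rewrite -ab; have [] := main v av.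
Qed.

End Germs.

(** * Apartments containing a path and the end of a sector *)

Section Straightening.
Context (R : realType) (V : vectType R) (I : finType).
Variables (D : vectorial_data V I) (AA : model_apartment D) (Delta : Type).
Variables (S : apartment_system V Delta) (HS : is_hovel AA S).
Local Notation slt := (slt D).
Local Notation sle := (sle D).
Local Notation is_chart := (is_chart S).

(** (MA3) is applied to the germ of a sector chimney, splayed because a chamber is a spherical face,
    and to the closed chamber at [p]. A ray deep in the chimney then lies in [B], and [chart_ray]
    turns it into agreement on a sector. *)
Lemma chart_sector A f A2 f2 s s2 p d d2 : is_chart A f -> is_chart A2 f2 ->
  slt s 0 d -> slt s2 0 d2 ->
  exists B g u e, [/\ is_chart B g, forall v, sle s u v -> f v = g v, 0 < e &
    forall t, 0 <= t <= e -> B (f2 (p + t *: d2))].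
Proof.
move=> cf cf2 dr d2r.
pose C s := vface D s \1%VF set0.
have CV s' : vectorial_face D (C s') by exists s', \1%VF, set0; split=> //; exact: weyl1.
pose RR := fmap f (chimney_germ AA (local_face 0 (C s)) (C s)).
pose F := fmap f2 (enclosure AA (local_face p (C s2))).
have [B [aB RB FB]] : exists B, [/\ apt S B, RR B & F B].
  apply: (hovel_MA3 HS).
    exists A, f, (chimney_germ AA (local_face 0 (C s)) (C s)).
    split; [exact: (proj1 cf)|exact: (proj2 cf)| |by []].
    exists 0, (C s), (C s); split=> //.
    by exists s, \1%VF, set0; split=> //; [exact: weyl1|exact: spherical_set0].
  exists A2, f2, (enclosure AA (local_face p (C s2))).
  split; [exact: (proj1 cf2)|exact: (proj2 cf2)| |by []].
  by left; exists p, (C s2).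
have [k2 [_ k2F k2B]] := FB.
have [|e /andP[e0 _] He] := germ_along (d := d2) k2F.
  by move=> t /andP[t0 _]; exists (t *: d2) => //; apply/vface_chamber/sltZ.
have [xi Cxi [k [_ [X [X0 gX0 X0X] XS] kB]]] := RB.
have [|e' /andP[e'0 _] He'] := germ_along (d := d) gX0.
  by move=> t /andP[t0 _]; exists (t *: d); rewrite ?add0r //; apply/vface_chamber/sltZ.
pose u0 := 0 + e' *: d + xi.
have Xu0 : X u0.
  apply: X0X; exists (0 + e' *: d); last by exists xi.
  by apply: He'; rewrite e'0 lexx.
have ray t : 0 <= t -> B (f (u0 + d + t *: d)).
  move=> t0; apply: kB; apply: XS; exists u0 => //; exists (d + t *: d); last by rewrite addrA.
  apply/vface_chamber; rewrite -{1}[d]scale1r -scalerDl; apply: sltZ => //; lra.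
have [g [cg Hg]] := chart_ray HS cf aB dr ray.
exists B, g, (u0 + d), e; split=> // t /andP[t0 te]; apply: k2B.
move: t0; rewrite le_eqVlt => /orP[/eqP<-|t0]; last by apply: He; rewrite t0.
rewrite scale0r addr0; exact: root_intersection_limit He.
Qed.

(* Real induction along the path from [a + d] back to [a]: (MA3) puts the end of
   [k] and a local chamber on either side of the current point in one apartment. *)
Lemma chart_straighten A f A' k s a d t1 :
  is_chart A f -> is_chart A' k -> slt s 0 d -> 0 <= t1 < 1 ->
  (forall t, t1 <= t <= 1 -> f (a + t *: d) = k (a + t *: d)) ->
  exists B g u, [/\ is_chart B g, forall v, sle s u v -> k v = g v &
    forall t, 0 <= t <= 1 -> f (a + t *: d) = g (a + t *: d)].
Proof.
move=> cf ck dr /andP[t10 t11] fk.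
pose good r := exists B g u, [/\ is_chart B g, forall v, sle s u v -> k v = g v &
    forall t, r <= t <= 1 -> f (a + t *: d) = g (a + t *: d)].
(* An apartment containing the end of [k] and the points at [r] and [r'] agrees, above the point at
   [r'], with the one already found. It therefore contains the endpoint at parameter 1, and so the
   whole path from [r] on. *)
have extend r r' B g u : good r' -> r <= r' -> r' < 1 -> is_chart B g ->
    (forall v, sle s u v -> k v = g v) -> B (f (a + r *: d)) ->
    B (f (a + r' *: d)) -> good r.
  move=> [B' [g' [u' [cg' kg' fg']]]] rr' r'1 cg kg Br Br'.
  have [w [uw u'w]] := sle_bound u u' dr.
  have [b gb] := chart_surj HS cg Br'.
  have [v wv||ab gg'] := @chart_agree _ _ _ _ _ _ _ HS B' g' B g s w (a + r' *: d) b d cg' cg dr.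
  - by rewrite -kg' ?kg //; apply: sle_trans wv; exact: sltW.
  - by rewrite -fg' ?gb // lexx ltW.
  have f1 : f (a + 1 *: d) = g (a + 1 *: d).
    rewrite fg'; last by rewrite lexx ltW.
    by apply: gg'; exact: slt_line.
  have r1 : r < 1 by exact: le_lt_trans r'1.
  have B1 : B (f (a + 1 *: d)) by rewrite f1; exact (chart_im HS cg _).
  have [h [ch Hh]] := chart_segment HS cf (proj1 cg) (slt_line a dr r1) Br B1.
  have {}Hh t : r <= t <= 1 -> f (a + t *: d) = h (a + t *: d).
    move=> /andP[rt t1']; have r10 : 0 < 1 - r by lra.
    have := Hh ((t - r) / (1 - r)).
    rewrite opprD addrACA subrr add0r -scalerBl scalerA -addrA -scalerDl.
    rewrite divfK ?gt_eqF // [r + _]addrC subrK; apply.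
    rewrite divr_ge0 ?ler_pdivrMr //; lra.
  exists B, g, u; split=> //.
  suff -> : g = h by [].
  apply: (chart_rigid HS cg ch (u := a + r' *: d) (v := a + 1 *: d)
    (v' := a + 1 *: d) (s := s)); try exact: slt_line.
    by rewrite -Hh; [rewrite -gb ab|lra].
  by rewrite -f1 Hh //; lra.
(* The parameter [t1 * (1 - t)] decreases from [t1] to 0, which turns real induction into motion
   backwards along the path. *)
suff H t : 0 <= t <= 1 -> good (t1 * (1 - t)).
  by have := H 1; rewrite subrr mulr0; apply; lra.
have base r : t1 <= r -> good r.
  move=> t1r; exists A', k, a; split=> // r' /andP[rr' r'1].
  by apply: fk; rewrite r'1 (le_trans t1r).
have dr' := slt_opp dr.
have [t1E|t1n0] := eqVneq t1 0; first by move=> _; apply: base; rewrite t1E mul0r.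
have t1p : 0 < t1 by rewrite lt_neqAle eq_sym t1n0.
apply: (@interval_induction _ (fun t => good (t1 * (1 - t)))).
- by apply: base; rewrite subr0 mulr1.
- move=> {}t /andP[t0 t1'] Pt; have rl : t1 * (1 - t) < 1 by nra.
  have Pr : good (t1 * (1 - t)) by apply: Pt; rewrite t0 lexx.
  (* To go on, the local chamber is taken towards [a]; in the limit case below it is taken towards
     the part of the path already treated. *)
  have [B [g [u [e [cg kg e0 He]]]]] := chart_sector (a + (t1 * (1 - t)) *: d) ck cf dr dr'.
  exists e => // v /andP[tv ve] v1.
  have B' x : t1 * (1 - t) - e <= x <= t1 * (1 - t) -> B (f (a + x *: d)).
    move=> xr; have := He (t1 * (1 - t) - x).
    rewrite scalerN -scaleNr opprB -addrA -scalerDl [_ + (x - _)]addrC subrK; apply.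
    lra.
  by apply: (extend _ _ B g u Pr) => //; [nra|apply: B'; nra|apply: B'; lra].
move=> {}t /andP[t0 t1'] Pt.
have [B [g [u [e [cg kg e0 He]]]]] := chart_sector (a + (t1 * (1 - t)) *: d) ck cf dr dr.
pose v := Num.max 0 (t - e).
have v0 : 0 <= v by rewrite le_max lexx.
have ve : t - e <= v by rewrite le_max lexx orbT.
have vt : v < t by rewrite gt_max; lra.
have B' x : t1 * (1 - t) <= x <= t1 * (1 - t) + e -> B (f (a + x *: d)).
  move=> xr; have := He (x - t1 * (1 - t)).
  rewrite -addrA -scalerDl [_ + (x - _)]addrC subrK; apply.
  lra.
apply: (extend _ _ B g u (Pt v _)) => //.
- by rewrite v0.
- nra.
- nra.
- by apply: B'; lra.
- by apply: B'; nra.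
Qed.

End Straightening.

(** * Rays at infinity *)

Section RaysAtInfinity.
Context (R : realType) (V : vectType R) (I : finType).
Variables (D : vectorial_data V I) (AA : model_apartment D) (Delta : Type).
Variables (S : apartment_system V Delta) (HS : is_hovel AA S).
Local Notation slt := (slt D).
Local Notation sle := (sle D).
Local Notation is_chart := (is_chart S).

Definition ray (f : V -> Delta) (a d : V) : set Delta := f @` vshift a (half_line d).

Lemma rayP f a d z : ray f a d z <-> exists2 t, 0 <= t & f (a + t *: d) = z.
Proof.
split=> [[_ [_ [t t0 <-] <-] <-]|[t t0 <-]]; first by exists t.
by exists (a + t *: d) => //; exists (t *: d) => //; exists t.
Qed.

(** Charts of one apartment differ by an affine map, so matching one pair of directions up to a
    positive factor matches all parallel rays. *)
Lemma ray_chart_change A f g u u0 d d2 l : is_chart A f -> is_chart A g ->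
  0 < l -> g u = f u0 -> g (u + d) = f (u0 + l *: d2) ->
  forall y, exists y', g y' = f y /\ ray f y d2 = ray g y' d.
Proof.
move=> cf cg l0 gu gud y; have [w Ww gE] := chart_change HS cf cg.
have [t wt] := Wa_linear Ww.
have [w' [_ _ w'K]] := Wa_inv Ww.
have wu : w u = u0 by apply: (chart_inj HS cf); rewrite -gu gE.
have wud : w (u + d) = u0 + l *: d2 by apply: (chart_inj HS cf); rewrite -gud gE.
have td : act D t d = l *: d2.
  by have := wt u (u + d); rewrite wu wud !(addrAC _ _ (- _)) !subrr !add0r.
have wE x r : w (x + r *: d) = w x + (r * l) *: d2.
  by rewrite -[LHS](subrK (w x)) wt addrAC subrr add0r actZ td scalerA addrC.
exists (w' y); split; first by rewrite gE /= w'K.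
rewrite eqEsubset; split=> z /rayP[r r0 <-]; apply/rayP.
  exists (r / l); first by rewrite divr_ge0 // ltW.
  by rewrite gE /= wE w'K divfK ?gt_eqF.
by exists (r * l); [rewrite mulr_ge0 // ltW|rewrite gE /= wE w'K].
Qed.

Lemma ray_direction A f g z x d d1 : is_chart A f -> is_chart A g ->
  d1 != 0 -> (forall t, 0 <= t -> ray f z d (g (x + t *: d1))) ->
  exists t0 l, [/\ 0 <= t0, 0 < l &
    forall t, g (x + t *: d1) = f (z + (t0 + t * l) *: d)].
Proof.
move=> cf cg d1n H; have [w Ww gE] := chart_change HS cf cg.
have [t wt] := Wa_linear Ww.
have pt r : 0 <= r -> exists2 r', 0 <= r' & w (x + r *: d1) = z + r' *: d.
  move=> /H /rayP[r' r'0 E]; exists r' => //.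
  by apply: (chart_inj HS cf); rewrite E gE.
have [t0 t00 w0] := pt 0 (lexx _); have [t1 t10 w1] := pt 1 ler01.
rewrite scale0r addr0 in w0; rewrite scale1r in w1.
have td : act D t d1 = (t1 - t0) *: d.
  have := wt x (x + d1); rewrite w0 w1 opprD addrACA subrr add0r -scalerBl.
  by rewrite addrAC subrr add0r => ->.
have wE r : w (x + r *: d1) = z + (t0 + r * (t1 - t0)) *: d.
  rewrite -[LHS](subrK (w x)) wt addrAC subrr add0r actZ td scalerA w0 addrC.
  by rewrite scalerDl addrA.
have act0 : act D t 0 = 0 by rewrite -[X in act D t X](subrr (0 : V)) actB subrr.
have dn : d != 0.
  apply: contra_neq d1n => dE; apply: (@act_inj _ _ _ D t).
  by rewrite td dE scaler0 act0.
exists t0, (t1 - t0); split=> // [|r]; last by rewrite gE /= wE.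
rewrite lt_neqAle; apply/andP; split.
  apply/eqP => E; move/eqP: d1n; apply; apply: (@act_inj _ _ _ D t).
  by rewrite td -E scale0r act0.
rewrite leNgt; apply/negP => ln.
(* If the direction were reversed, this parameter would land at [-1], outside the ray. *)
have [|r' r'0 rE] := pt ((t0 + 1) / (t0 - t1)); first by apply: divr_ge0; lra.
move: rE; rewrite wE => /addrI/eqP; rewrite -subr_eq0 -scalerBl scaler_eq0 (negPf dn) orbF.
have -> : (t0 + 1) / (t0 - t1) * (t1 - t0) = - (t0 + 1).
  by field; rewrite subr_eq0; apply/negP => /eqP; lra.
by move=> /eqP {gE}; lra.
Qed.

(** One link of a chain of shortenings: the chart [g] of [A1] inherits an end of the sector of [f],
    and in it all translates of the ray of [f1] acquire the normalized direction [d]. *)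
Lemma subray_chart A f A1 f1 s d z x1 K1 : is_chart A f -> is_chart A1 f1 ->
  slt s 0 d -> generic_line D K1 -> f1 @` vshift x1 K1 `<=` ray f z d ->
  exists g u, [/\ is_chart A1 g, forall v, sle s u v -> f v = g v &
    forall y, exists y', g y' = f1 y /\ f1 @` vshift y K1 = ray g y' d].
Proof.
move=> cf cf1 dr gK1 sub; have [d1 [d1n _ KE]] := gK1; subst K1.
have [||g [k [cg kF kE]]] := @chart_share _ _ _ _ _ _ _ HS A1 f1 A
  (globally (vshift x1 (half_line d1))) cf1 (proj1 cf).
- by constructor 3; exists x1, (half_line d1).
- move=> v xv; have /rayP[r _ fr] : ray f z d (f1 v) by apply: sub; exists v.
  by rewrite /preimage /= -fr; exact (chart_im HS cf _).
have f1g t : 0 <= t -> f1 (x1 + t *: d1) = g (x1 + t *: d1).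
  by move=> t0; apply/kE/kF; exists (t *: d1) => //; exists t.
have [t t0|t0 [l [t00 l0 gf]]] := @ray_direction A f g z x1 d d1 cf cg d1n.
  by rewrite -f1g //; apply/sub/rayP; exists t.
have E t : 0 <= t -> f (z + t0 *: d + t *: d) = f1 (x1 + (t / l) *: d1).
  move=> t0'; rewrite f1g ?divr_ge0 ?(ltW l0) // gf divfK ?gt_eqF //.
  by rewrite scalerDl addrA.
have [t t0'|h [ch fh]] := chart_ray HS cf (proj1 cf1) dr (u := z + t0 *: d).
  by rewrite E //; exact (chart_im HS cf1 _).
exists h, (z + t0 *: d); split=> // y.
have fh' t : 0 <= t -> f (z + t0 *: d + t *: d) = h (z + t0 *: d + t *: d).
  move=> t0'; apply: fh; rewrite -{1}[z + t0 *: d]addr0 -(scale0r d).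
  exact: sle_line.
apply: (ray_chart_change (u := z + t0 *: d) (u0 := x1) (l := l^-1) cf1 ch).
- by rewrite invr_gt0.
- have := E 0 (lexx _); have := fh' 0 (lexx _).
  by rewrite mul0r !scale0r !addr0 => -> ->.
have := E 1 ler01; have := fh' 1 ler01.
by rewrite mul1r !scale1r => -> ->.
Qed.

Lemma superray_chart A f A1 f1 s d z x1 K1 : is_chart A f -> is_chart A1 f1 ->
  slt s 0 d -> generic_line D K1 -> ray f z d `<=` f1 @` vshift x1 K1 ->
  exists g u, [/\ is_chart A1 g, forall v, sle s u v -> f v = g v &
    forall y, exists y', g y' = f1 y /\ f1 @` vshift y K1 = ray g y' d].
Proof.
move=> cf cf1 dr gK1 sub; have [d1 [d1n _ KE]] := gK1; subst K1.
have [t t0|g [cg fg]] := chart_ray HS cf (proj1 cf1) dr (u := z).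
  have /rayP[r _ <-] : ray f1 x1 d1 (f (z + t *: d)).
    by apply/sub/rayP; exists t.
  exact (chart_im HS cf1 _).
exists g, z; split=> // y.
have fg' t : 0 <= t -> f (z + t *: d) = g (z + t *: d).
  move=> t0; apply: fg; rewrite -{1}[z]addr0 -(scale0r d); exact: sle_line.
have [t t0|t0 [l [t00 l0 gf]]] := @ray_direction A1 f1 g x1 z d1 d cf1 cg (slt_neq0 dr).
  by rewrite -fg' //; apply/sub/rayP; exists t.
apply: (ray_chart_change (u := z) (u0 := x1 + t0 *: d1) (l := l) cf1 cg) => //.
  by have := gf 0; rewrite mul0r scale0r !addr0.
by have := gf 1; rewrite mul1r scale1r scalerDl addrA.
Qed.

(** Parallelism consists of a subray of the first ray and a subray of the second that are translates
    of each other: the direction passes down through the first inclusion and up through the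
    second. *)
Lemma parallel_chart A0 f0 s d z A2 f2 a K2 : is_chart A0 f0 -> slt s 0 d ->
  is_chart A2 f2 -> generic_line D K2 ->
  parallel S (generic_line D) (ray f0 z d) (f2 @` vshift a K2) ->
  exists g b u, [/\ is_chart A2 g, g b = f2 a, f2 @` vshift a K2 = ray g b d &
    forall v, sle s u v -> f0 v = g v].
Proof.
move=> cf0 dr cf2 gK2 [A1 [f1 [x1 [y1 [K1 [aA1 cf1 gK1 [sub1 _] [sub2 _]]]]]]].
have [g [u [cg f0g /(_ y1)[y' [_ E]]]]] :=
  subray_chart cf0 (conj aA1 cf1) dr gK1 sub1.
rewrite E in sub2.
have [h [u' [ch gh /(_ a)[b [hb Eb]]]]] := superray_chart cg cf2 dr gK2 sub2.
have [w [uw u'w]] := sle_bound u u' dr.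
exists h, b, w; split=> // v wv.
by rewrite f0g ?gh //; apply: sle_trans wv; exact: sltW.
Qed.

Lemma ray_to_chart A0 f0 s d z x : is_chart A0 f0 -> slt s 0 d ->
  exists A f a u, [/\ is_chart A f, f a = x,
    ray_to D S x (parallel_class S (generic_line D) (ray f0 z d)) = ray f a d &
    forall v, sle s u v -> f0 v = f v].
Proof.
move=> cf0 dr; set xi := parallel_class _ _ _.
pose P X := xi X /\ exists A f a K, [/\ apt S A, chart S A f,
  generic_line D K, f a = x & X = f @` vshift a K].
have [A2 [aA2 A2x]] : exists A, apt S A /\ A x.
  by have : setT x by []; rewrite -(hovel_cover HS) => -[A aA Ax]; exists A.
have [f2 cf2] := apt_chart HS aA2; have [p f2p] := chart_surj HS cf2 A2x.
have [B [g [u [e [cg f0g e0 He]]]]] := chart_sector HS p cf0 cf2 dr dr.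
have Bx : B x by rewrite -f2p -[p]addr0 -(scale0r d); apply: He; rewrite lexx ltW.
have [b gb] := chart_surj HS cg Bx.
have gd := slt_generic dr.
have Pex : exists X, P X.
  have [T T0 HT] := slt_large z u dr.
  have tail t : 0 <= t -> f0 (z + T *: d + t *: d) = g (z + T *: d + t *: d).
    by move=> t0; rewrite -addrA -scalerDl; apply/f0g/sltW/HT; lra.
  have [[aA0 cf0'] [aB cg']] := (cf0, cg).
  have tE : ray g (z + T *: d) d = ray f0 (z + T *: d) d.
    by rewrite eqEsubset; split=> y /rayP[t t0 <-]; apply/rayP; exists t; rewrite ?tail.
  exists (ray g b d); split; last by exists B, g, b, (half_line d).
  split; first by exists B, g, b, (half_line d).
  exists B, g, (z + T *: d), b, (half_line d); split=> //; last first.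
    by split=> //; exists B, g, b, b, (half_line d).
  rewrite -/(ray g (z + T *: d) d) tE; split.
    move=> y /rayP[t t0 <-]; apply/rayP; exists (T + t); first lra.
    by rewrite scalerDl addrA.
  by exists A0, f0, z, (z + T *: d), (half_line d).
have [[_ par] [A [f [a [K [aA cf gK fa XE]]]]]] : P (ray_to D S x xi).
  exact: (@getPex (set Delta) P Pex).
rewrite XE in par *.
have [h [b' [u' [ch hb E f0h]]]] := parallel_chart cf0 dr (conj aA cf) gK par.
by exists A, h, b', u'; split=> //; rewrite hb.
Qed.

Lemma segmentE A f s a d t : is_chart A f -> slt s 0 d -> 0 <= t ->
  segment D S (f a) (f (a + t *: d)) = f @` vsegment a (a + t *: d).
Proof.
move=> cf dr t0; set P := fun X => exists A f' a' b', [/\ apt S A, chart S A f',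
  preordered D a' b', f' a' = f a /\ f' b' = f (a + t *: d) & X = f' @` vsegment a' b'].
have pre : preordered D a (a + t *: d).
  move: t0; rewrite le_eqVlt => /orP[/eqP<-|t0].
    by rewrite scale0r addr0; left; exact: vle_refl.
  apply: (@slt_preordered _ _ _ _ s); rewrite -{1}[a]addr0 -(scale0r d).
  exact: slt_line.
have [A' [f' [a' [b' [aA' cf' pre' [fa fb] XE]]]]] : P (segment D S (f a) (f (a + t *: d))).
  apply: (@getPex (set Delta) P); exists (f @` vsegment a (a + t *: d)).
  by exists A, f, a, (a + t *: d); split=> //; [exact: (proj1 cf)|exact: (proj2 cf)].
by rewrite XE; apply: (segment_eq HS (conj aA' cf') cf) fa fb pre'.
Qed.

Lemma segment_ray A f s a d t u : is_chart A f -> slt s 0 d -> 0 <= t ->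
  segment D S (f a) (f (a + t *: d)) (f (a + u *: d)) <-> 0 <= u <= t.
Proof.
move=> cf dr t0; rewrite (segmentE _ cf dr t0); split.
  move=> [_ [r /andP[r0 r1] <-] /(chart_inj HS cf)/addrI/eqP].
  rewrite addrAC subrr add0r scalerA -subr_eq0 -scalerBl scaler_eq0.
  rewrite (negPf (slt_neq0 dr)) orbF subr_eq0 => /eqP <-.
  by apply/andP; split; [exact: mulr_ge0|rewrite ler_piMl //].
move=> /andP[u0 ut]; exists (a + u *: d) => //.
move: t0; rewrite le_eqVlt => /orP[/eqP tE|t0].
  exists 0; first by rewrite /= lexx ler01.
  have u00 : u = 0 by apply: le_anti; rewrite u0 andbT tE.
  by rewrite u00 !scale0r.
exists (u / t); first by rewrite /= divr_ge0 ?ler_pdivrMr ?mul1r // ltW.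
by rewrite addrAC subrr add0r scalerA divfK ?gt_eqF.
Qed.

End RaysAtInfinity.

(** * Change of base point *)

Section BasePoint.
Context (R : realType) (V : vectType R) (I : finType).
Variables (D : vectorial_data V I) (AA : model_apartment D) (Delta : Type).
Variables (S : apartment_system V Delta) (HS : is_hovel AA S).
Local Notation slt := (slt D).
Local Notation sle := (sle D).
Local Notation is_chart := (is_chart S).

(* The primed data describe rays from the same points [f a] and [h b] towards
   another ideal point. *)
Lemma ray_base_change A f A' h s d u a b r :
  is_chart A f -> is_chart A' h -> slt s 0 d ->
  (forall v, sle s u v -> f v = h v) -> 0 <= r ->
  exists2 T, 0 <= T & forall A1 f1 A2 h1 s' d' u1 a1 b1 T',
    is_chart A1 f1 -> is_chart A2 h1 -> slt s' 0 d' ->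
    (forall v, sle s' u1 v -> f1 v = h1 v) ->
    f1 a1 = f a -> h1 b1 = h b -> T < T' -> ray h1 b1 d' (h (b + T' *: d)) ->
    forall t, 0 <= t <= r + 1 -> ray f1 a1 d' (f (a + t *: d)).
Proof.
move=> cf ch dr fh r0.
have [T1 T10 HT1] := slt_large b u dr.
have [T2 T20 HT2] := slt_large b (a + (r + 1) *: d) dr.
(* The point [m] at parameter [t2] must lie above [u], where [f] and [h] agree, and above the point
   at [r + 1], which is beyond the gate at [r]. Only the unprimed data enter. *)
pose t2 := Num.max T1 T2.
have t2T1 : T1 <= t2 by rewrite le_max lexx.
have t2T2 : T2 <= t2 by rewrite le_max lexx orbT.
exists t2; first lra.
move=> A1 f1 A2 h1 s' d' u1 a1 b1 T' cf1 ch1 d'r f1h1 fa hb TT'.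
move=> /rayP[T'' T''0 ET].
have T'0 : 0 < T' by lra.
have T''p : 0 < T''.
  rewrite lt_neqAle T''0 andbT; apply/eqP => T''E; move: ET.
  rewrite -T''E scale0r addr0 hb -{1}[b]addr0 => /(chart_inj HS ch)/addrI/eqP.
  by rewrite eq_sym scaler_eq0 (negPf (slt_neq0 dr)) orbF gt_eqF.
have bq : slt s b (b + T' *: d).
  by rewrite -{1}[b]addr0 -(scale0r d); exact: slt_line.
(* [k] is a chart of the apartment of [h1] that agrees with [h] between [b] and the common point at
   [T']; in it the primed rays have direction [d]. *)
have [||k [ck Hk1 Hk2]] := chart_interval HS ch (proj1 ch1) bq.
- by rewrite -hb; exact (chart_im HS ch1 _).
- by rewrite -ET; exact (chart_im HS ch1 _).
have kb : k b = h1 b1.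
  by rewrite hb; have := Hk1 0; rewrite scale0r addr0 => ->//; rewrite lexx ler01.
have kbT : k (b + T' *: d) = h1 (b1 + T'' *: d').
  rewrite ET; have := Hk1 1; rewrite scale1r [b + (_ - b)]addrC subrK => -> //.
  by rewrite lexx ler01.
have rayZ x : ray k x (T' *: d) `<=` ray k x d.
  move=> y /rayP[t t0 <-]; apply/rayP; exists (t * T'); first by rewrite mulr_ge0 // ltW.
  by rewrite scalerA.
have [u1' [_ Eu]] := ray_chart_change HS ch1 ck T''p kb kbT u1.
have sub : f1 @` vshift u1 (half_line d') `<=` ray k u1' d.
  apply: subset_trans (rayZ u1'); rewrite -Eu => y /rayP[t t0 <-]; apply/rayP.
  exists t => //; apply/esym/f1h1; rewrite -{1}[u1]addr0 -(scale0r d').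
  exact: sle_line.
have [g [u2 [cg kg /(_ a1)[a2 [ga2 Ea]]]]] :=
  subray_chart HS ck cf1 dr (slt_generic d'r) sub.
rewrite -/(ray f1 a1 d') in Ea.
pose m := b + t2 *: d.
have um : slt s u m by exact: HT1.
have rm : slt s (a + (r + 1) *: d) m by exact: HT2.
have aE t : 0 <= t -> sle s a (a + t *: d).
  by move=> t0; rewrite -{1}[a]addr0 -(scale0r d); exact: sle_line.
have am : slt s a m by apply: sle_lt_trans rm; apply: aE; lra.
have bm : slt s b m by rewrite -{1}[b]addr0 -(scale0r d); apply: slt_line => //; lra.
have mq : slt s m (b + T' *: d) by exact: slt_line.
have amd : slt s 0 (m - a) by move/slt_sub: am.
have [e1 e10 He1] := slt_approach a um; have [e2 e20 He2] := slt_approach a bm.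
(* From [t1] on, the path from [a] to [m] stays above [u] and [b], so that [f], [h] and [k] agree
   along it. *)
pose t1 := Num.max 0 (1 - Num.min e1 e2).
have t10 : 0 <= t1 by rewrite le_max lexx.
have t1m : 1 - Num.min e1 e2 <= t1 by rewrite le_max lexx orbT.
have me1 : Num.min e1 e2 <= e1 by rewrite ge_min lexx.
have me2 : Num.min e1 e2 <= e2 by rewrite ge_min lexx orbT.
have m0 : 0 < Num.min e1 e2 by rewrite lt_min e10.
have t11 : t1 < 1 by rewrite gt_max; lra.
have amE : a + 1 *: (m - a) = m by rewrite scale1r addrC subrK.
have [||B [g' [u3 [cg' kg' fg']]]] :=
  @chart_straighten _ _ _ _ _ _ _ HS A f A2 k s a (m - a) t1 cf ck amd.
- by rewrite t10.
- move=> t /andP[tt1 t1'].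
  have ptm : sle s (a + t *: (m - a)) m.
    by rewrite -[X in sle _ _ X]amE; exact: sle_line.
  rewrite fh; last by apply/sltW/He1; lra.
  apply: Hk2; first by apply: He2; lra.
  exact: sle_lt_trans mq.
have fa' : f a = g' a.
  by have := fg' 0; rewrite scale0r addr0; apply; rewrite lexx ler01.
have fm : f m = g' m.
  by have := fg' 1; rewrite amE; apply; rewrite lexx ler01.
have [w [u2w u3w]] := sle_bound u2 u3 dr.
(* [g] and [g'] both agree with [k] far out and reach the same point, hence they agree on the sector
   based at [a]. It remains to compare [g'] with [f] below [m]. *)
have [v wv||a2E gg'] := @chart_agree _ _ _ _ _ _ _ HS A1 g B g' s w a2 a d cg cg' dr.
- by rewrite -kg ?kg' //; apply: sle_trans wv; exact: sltW.
- by rewrite ga2 fa.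
subst a2.
have [||g3 [cg3 Hg3 Hg3']] := chart_interval HS cf (proj1 cg') am.
- by rewrite fa'; exact (chart_im HS cg' _).
- by rewrite fm; exact (chart_im HS cg' _).
have g3E : g' = g3.
  apply: (chart_rigid HS cg' cg3 (u := a) (v := m) (v' := m) (s := s)) => //.
    by rewrite -fa'; have := Hg3 0; rewrite scale0r addr0; apply; rewrite lexx ler01.
  by rewrite -fm; have := Hg3 1; rewrite amE; apply; rewrite lexx ler01.
move=> t /andP[t0 tr]; rewrite Ea; apply/rayP; exists t => //.
move: t0; rewrite le_eqVlt => /orP[/eqP<-|t0].
  by rewrite scale0r addr0 ga2 fa.
have at' : slt s a (a + t *: d).
  by rewrite -{1}[a]addr0 -(scale0r d); exact: slt_line.
rewrite gg' // g3E Hg3' //.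
by apply: sle_lt_trans rm; exact: sle_line.
Qed.

End BasePoint.

(** * Standard neighbourhoods and the cone topology *)

Section ConeTopology.
Context (R : realType) (V : vectType R) (I : finType).
Variables (D : vectorial_data V I) (AA : model_apartment D) (Delta : Type).
Variables (S : apartment_system V Delta) (HS : is_hovel AA S).
Variables (bary : Ch D S -> set (set Delta)) (Hbary : barycenter_choice bary).
Local Notation slt := (slt D).
Local Notation sle := (sle D).
Local Notation is_chart := (is_chart S).

(** Composing the chart with the Weyl group element that carries the base chamber to the direction
    of the ray puts the direction in $\pm C^v_f$, as all results on charts require. *)
Lemma barycenter_chart c : exists s d A f z, [/\ is_chart A f, slt s 0 d &
  bary c = parallel_class S (generic_line D) (ray f z d)].
Proof.
have [_ /(_ c)[A [f [x [z [C [d [[aA cf [s [w [Ww CE]]] Cd] [_ _ ->]]]]]]]] _] := Hbary.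
have [t wt] := Wv_act Ww.
move: Cd; rewrite CE => -[v [_ v0] dE].
have cf' := chart_comp HS (conj aA cf) (Wa_act AA t).
exists s, ((-1) ^+ s *: v), A, (f \o act D t), (act D (rev t) z); split=> //.
  by apply/vface_chamber; exists v; rewrite ?id_lfunE.
congr (parallel_class _ _ _).
have dE' : act D t ((-1) ^+ s *: v) = d by rewrite actZ -wt.
by rewrite eqEsubset; split=> y /rayP[r r0 <-]; apply/rayP; exists r;
  rewrite //= actD actZ dE' act_Krev.
Qed.

Lemma ray_to_barycenter x c : exists s d A f a, [/\ is_chart A f, slt s 0 d,
  f a = x & ray_to D S x (bary c) = ray f a d].
Proof.
have [s [d [A [f [z [cf dr ->]]]]]] := barycenter_chart c.
have [A' [f' [a [u [cf' fa E _]]]]] := ray_to_chart HS z x cf dr.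
by exists s, d, A', f', a.
Qed.

Lemma ray_to_segment x c e : ray_to D S x (bary c) e ->
  segment D S x e `<=` ray_to D S x (bary c).
Proof.
have [s [d [A [f [a [cf dr <- ->]]]]]] := ray_to_barycenter x c.
move=> /rayP[t t0 <-] y; rewrite (segmentE HS _ cf dr t0).
move=> [_ [r /andP[r0 r1] <-] <-]; apply/rayP; exists (r * t); first exact: mulr_ge0.
by rewrite addrAC subrr add0r scalerA.
Qed.

Lemma ray_to_total x c e e' : ray_to D S x (bary c) e ->
  ray_to D S x (bary c) e' -> segment D S x e e' \/ segment D S x e' e.
Proof.
have [s [d [A [f [a [cf dr <- ->]]]]]] := ray_to_barycenter x c.
move=> /rayP[t t0 <-] /rayP[t' t0' <-]; rewrite !(segment_ray HS _ _ cf dr) // t0 t0'.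
by case: (leP t t') => h; [right|left]; rewrite ?(ltW h).
Qed.

Lemma segment_end x c e : ray_to D S x (bary c) e -> segment D S x e e.
Proof. by move=> e_c; case: (ray_to_total e_c e_c). Qed.

Lemma std_nbhdP x r c c' : std_nbhd bary x r c c' <->
  segment D S x r `<=` ray_to D S x (bary c') `&` ray_to D S x (bary c) /\
  exists e, [/\ ray_to D S x (bary c') e, ray_to D S x (bary c) e &
    ~ segment D S x r e].
Proof.
split=> -[sub].
  move=> /existsNP[e /not_implyP[[ec' ec] er]]; split=> //.
  by exists e.
by move=> [e [ec' ec er]]; split=> // /(_ e); apply: contra_not er; apply.
Qed.

Lemma std_nbhd_gate x r c : ray_to D S x (bary c) r ->
  std_nbhd bary x r c c.
Proof.
move=> rc; apply/std_nbhdP; split.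
  by rewrite setIid; exact: ray_to_segment.
move: rc; have [s [d [A [f [a [cf dr <- ->]]]]]] := ray_to_barycenter x c.
move=> /rayP[t t0 <-]; exists (f (a + (t + 1) *: d)).
have t10 : 0 <= t + 1 by lra.
by split; [apply/rayP; exists (t + 1)..|rewrite (segment_ray HS _ _ cf dr) //; lra].
Qed.

(** Any member may serve as centre with the same gate: of the two witnesses beyond the gate, both on
    the ray of [c'], the one nearer to [x] lies on all three rays. *)
Lemma std_nbhd_center x r c c' : ray_to D S x (bary c) r ->
  std_nbhd bary x r c c' ->
  ray_to D S x (bary c') r /\ std_nbhd bary x r c' `<=` std_nbhd bary x r c.
Proof.
move=> rc /std_nbhdP[sub [e [ec' ec er]]].
split; first by have [] := sub r (segment_end rc).
move=> c2 /std_nbhdP[sub2 [e2 [e2c2 e2c' e2r]]]; apply/std_nbhdP; split.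
  by move=> y yr; split; [case: (sub2 y yr)|case: (sub y yr)].
have [e2e|ee2] := ray_to_total ec' e2c'.
  by exists e2; split=> //; exact: ray_to_segment e2e.
by exists e; split=> //; exact: ray_to_segment ee2.
Qed.

Lemma std_nbhd_base_change x y r c : ray_to D S x (bary c) r ->
  exists2 r', ray_to D S y (bary c) r' & std_nbhd bary y r' c `<=` std_nbhd bary x r c.
Proof.
have [s [d [A0 [f0 [z [cf0 dr bE]]]]]] := barycenter_chart c.
have [A [f [a [u [cf fa xE f0f]]]]] := ray_to_chart HS z x cf0 dr.
have [A' [h [b [u' [ch hb yE f0h]]]]] := ray_to_chart HS z y cf0 dr.
rewrite -bE in xE yE.
have [w [uw u'w]] := sle_bound u u' dr.
have fh v : sle s w v -> f v = h v.
  by move=> wv; rewrite -f0f ?f0h //; apply: sle_trans wv; exact: sltW.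
rewrite xE => /rayP[t t0 rE].
have [T T0 HT] := ray_base_change HS a b cf ch dr fh t0.
exists (h (b + T *: d)); first by rewrite yE; apply/rayP; exists T.
move=> c' /std_nbhdP[_ [e [ec' ec eT]]].
move: ec; rewrite yE => /rayP[T' T'0 eE].
(* The witness of strict inclusion lies beyond the gate, which is the form in which
   [ray_base_change] uses the hypothesis. *)
have TT' : T < T'.
  by rewrite ltNge; apply/negP => le; apply: eT; rewrite -eE -hb (segment_ray HS _ _ ch dr) // T'0.
have [s' [d' [A0' [f0' [z' [cf0' dr' bE']]]]]] := barycenter_chart c'.
have [A1 [f1 [a1 [u1 [cf1 fa1 xE' f0f1]]]]] := ray_to_chart HS z' x cf0' dr'.
have [A2 [h1 [b1 [u2 [ch1 hb1 yE' f0h1]]]]] := ray_to_chart HS z' y cf0' dr'.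
rewrite -bE' in xE' yE'.
have [w' [uw' u'w']] := sle_bound u1 u2 dr'.
have fh1 v : sle s' w' v -> f1 v = h1 v.
  by move=> wv; rewrite -f0f1 ?f0h1 //; apply: sle_trans wv; exact: sltW.
have H := HT A1 f1 A2 h1 s' d' w' a1 b1 T' cf1 ch1 dr' fh1.
rewrite fa hb eE -yE' -xE' in H; have {}H := H fa1 hb1 TT' ec'.
have t10 : 0 <= t + 1 by lra.
apply/std_nbhdP; rewrite xE; split.
  move=> p; rewrite -rE -fa (segmentE HS _ cf dr t0) fa => -[_ [q /andP[q0 q1] <-] <-].
  have qE : a + q *: (a + t *: d - a) = a + (q * t) *: d.
    by rewrite addrAC subrr add0r scalerA.
  rewrite qE; split.
    by apply: H; apply/andP; split; nra.
  by apply/rayP; exists (q * t) => //; exact: mulr_ge0.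
(* The extra unit of length obtained from [ray_base_change] shows that the common part goes strictly
   past the gate. *)
exists (f (a + (t + 1) *: d)); split.
- by apply: H; lra.
- by apply/rayP; exists (t + 1).
- by rewrite -rE -fa (segment_ray HS _ _ cf dr) //; lra.
Qed.

Lemma cone_topology_sub x y : cone_topology bary x `<=` cone_topology bary y.
Proof.
have topy : is_topology (cone_topology bary y).
  split.
  - by move=> M [[MT _ _] _].
  - move=> U U' HU HU' M MP; have [[_ MI _] _] := MP.
    by apply: MI; [exact: HU|exact: HU'].
  - move=> F HF M MP; have [[_ _ MU] _] := MP.
    by apply: MU => U /HF; apply.
apply: smallest_sub => // _ [c [r [rc ->]]].
(* A standard neighbourhood at [x] is recentred at each of its members, and there it contains a
   standard neighbourhood at [y]; so it is the union of those it contains. *)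
pose G := [set U | (exists c' r', ray_to D S y (bary c') r' /\ U = std_nbhd bary y r' c')
  /\ U `<=` std_nbhd bary x r c].
have -> : std_nbhd bary x r c = \bigcup_(U in G) U.
  rewrite eqEsubset; split=> [c' c'U|c' [U [_ sub]]]; last exact: sub.
  have [rc' sub] := std_nbhd_center rc c'U.
  have [r' r'c' sub'] := std_nbhd_base_change y rc'.
  exists (std_nbhd bary y r' c'); last exact: std_nbhd_gate.
  by split; [exists c', r'|exact: subset_trans sub].
have [_ _ HU] := topy.
by apply: HU => U [bU _]; apply: sub_gen_smallest.
Qed.

End ConeTopology.

Theorem proposition4p3 (R : realType) (V : vectType R) (I : finType)
    (D : vectorial_data V I) (AA : model_apartment D) (Delta : Type)
    (S : apartment_system V Delta) (HS : is_hovel AA S)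
    (bary : Ch D S -> set (set Delta)) (Hbary : barycenter_choice bary)
    (x y : Delta) (xy : x <> y) :
  cone_topology bary x = cone_topology bary y.
Proof. by rewrite eqEsubset; split; exact: (cone_topology_sub HS Hbary). Qed.
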